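(* Let $K$ be a number field. Suppose that for every $\epsilon>0$ there is a constant $C_1=C_1(K,\epsilon)>0$ such that $$\mathbb{N}_{K/\mathbb{Q}}(\Delta(\phi))\leq C_1\,\mathbb{N}_{K/\mathbb{Q}}(\mathfrak{R}(\Delta(\phi)))^{30+\epsilon}\qquad\text{for all }\phi\in\mathcal{F}_{4,4}(K),$$ where $\Delta(\phi)$ denotes the minimal critical discriminant of $\phi$. Then for every $\epsilon>0$ there is a constant $C_2=C_2(K,\epsilon)>0$ such that $$\mathbb{N}_{K/\mathbb{Q}}(\Delta(E))\leq C_2\,\mathbb{N}_{K/\mathbb{Q}}(\mathfrak{R}(\Delta(E)))^{6+\epsilon}$$ for all semistable elliptic curves $E/K$, where $\Delta(E)$ denotes the minimal discriminant of $E/K$. (That is, the conjectural bound on the minimal critical discriminant for the family $\mathcal{F}_{4,4}(K)$ implies Szpiro's conjecture for semistable elliptic curves over $K$.)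
   Context: Let $K$ be a number field with ring of integers $\mathcal{O}_K$ and algebraic closure $\bar K$. Let $M_K$ be the set of places of $K$ and $M_K^0$ the set of non-Archimedean places. For $v\in M_K^0$, let $\mathfrak{p}_v$ be the associated prime ideal of $\mathcal{O}_K$, $\mathrm{ord}_v$ the normalized valuation, and $\mathcal{O}_v$ the ring of $v$-integral elements of $K$. For an ideal $\mathfrak{a}$ of $\mathcal{O}_K$, $\mathfrak{R}(\mathfrak{a})=\prod_{\mathfrak{p}\mid\mathfrak{a}}\mathfrak{p}$ is its radical, the squarefree product of the prime ideals dividing it, and $\mathbb{N}_{K/\mathbb{Q}}$ is the ideal norm. Elliptic curves. The minimal discriminant of an elliptic curve $E/K$ is the ideal $\Delta(E)=\prod_{v\in M_K^0}\mathfrak{p}_v^{\delta_v(E)}$, where $\delta_v(E)$ is the minimal value of $\mathrm{ord}_v(\Delta)$ over the discriminants $\Delta$ of all $v$-integral Weierstrass equations for $E$ over $K$. $E/K$ is semistable if it has good or multiplicative reduction at every $v\in M_K^0$. Rational maps. Identify $\mathbb{P}^1$ with $\mathbb{A}^1\cup\{\infty\}$. For $d\ge2$ and $\lambda\in K^\times$, a rational map $\phi$ of degree $d$ over $K$ for which $\infty$ is a fixed point with multiplier $\lambda$ (derivative at the fixed point, computed at $\infty$ in the coordinate $1/x$) can be written uniquely as $$\phi(x)=\frac{x^d+a_{d-1}x^{d-1}+\dots+a_0}{\lambda x^{d-1}+b_{d-2}x^{d-2}+\dots+b_0}\qquad( * )$$ with $a_j,b_j\in K$ and numerator and denominator having no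 common roots in $\bar K$. $\phi$ is critically separable if it has $2d-2$ distinct critical points in $\mathbb{P}^1(\bar K)$. $\mathcal{F}_{d,\lambda}(K)$ is the set of all rational maps $\phi:\mathbb{P}^1_K\to\mathbb{P}^1_K$ of degree $d$ which are critically separable, have $\infty$ as a fixed point with multiplier $\lambda$, and satisfy, when written as in $( * )$, $a_{d-1}=\frac{d-\lambda}{(d-1)\lambda}\,b_{d-2}$. Two maps $\phi,\psi\in\mathcal{F}_{d,\lambda}(K)$ are isomorphic if $\sigma\circ\phi\circ\sigma^{-1}=\psi$ for some $\sigma\in\mathrm{Aut}^\infty(\mathbb{P}^1_K)=\{x\mapsto\alpha x+\beta\mid\alpha\in K^\times,\beta\in K\}$. Critical discriminant. A pair $(A(x),B(x))$ of polynomials in $K[x]$ is in standard form (with respect to $(d,\lambda)$) if $A$ is monic of degree $d$ and $B$ has degree $d-1$ and leading coefficient $\lambda$. Its Wronskian is $W_{A,B}(x)=B(x)A'(x)-A(x)B'(x)$, a polynomial of degree $2d-2$ with leading coefficient $\lambda$, and its critical discriminant is $\Delta_{A,B}=\mathrm{disc}(W_{A,B})$, where $\mathrm{disc}(P)=a^{2N-2}\prod_{m<n}(r_m-r_n)^2$ for $P(x)=a\prod_{n=1}^N(x-r_n)$. Minimal critical discriminant. Let $S_\lambda$ be the finite set of places of $K$ which are either Archimedean or satisfy $\lambda\notin\mathcal{O}_v$. For $\phi\in\mathcal{F}_{d,\lambda}(K)$ and $v\in M_K\setminus S_\lambda$, let $\delta_v(\phi)$ be the minimal value of $\mathrm{ord}_v(\Delta_{A,B})$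 over all pairs $(A(x),B(x))$ of polynomials in standard form with coefficients in $\mathcal{O}_v$ such that the rational map $\psi(x)=A(x)/B(x)$ is isomorphic to $\phi$. The minimal critical discriminant of $\phi$ is the integral ideal $\Delta(\phi)=\prod_{v\in M_K\setminus S_\lambda}\mathfrak{p}_v^{\delta_v(\phi)}$ of $\mathcal{O}_K$. The general conjectural bound has exponent $(2d-2)(2d-3)+\epsilon$ (for $d\ge3$), which equals $30+\epsilon$ when $d=4$. *)

(* Defs.v *)
From HB Require Import structures.
From mathcomp Require Import all_boot all_order all_algebra all_field.
From mathcomp Require Import boolp classical_sets functions cardinality fsbigop.
From mathcomp Require Import reals exp.

Set Implicit Arguments.
Unset Strict Implicit.
Unset Printing Implicit Defensive.
Import Order.TTheory GRing.Theory Num.Theory.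
Local Open Scope classical_set_scope.
Local Open Scope ring_scope.

(* Junk value 0 on the empty set. *)
Definition least (S : set nat) : nat :=
  xget 0%N [set n | S n /\ forall m, S m -> (n <= m)%N].

Section Ideals.
Variable K : fieldExtType rat.

Definition ring_of_integers : set K :=
  [set x | integralOver (intr : int -> K) x].

Definition is_ideal (I : set K) : Prop :=
  [/\ I `<=` ring_of_integers, I 0,
      forall x y, I x -> I y -> I (x + y)
    & forall a x, ring_of_integers a -> I x -> I (a * x)].

Definition is_prime_ideal (P : set K) : Prop :=
  [/\ is_ideal P, ~ P 1
    & forall x y, ring_of_integers x -> ring_of_integers y ->
        P (x * y) -> P x \/ P y].

Definition ideal_mul (I J : set K) : set K :=
  [set x | exists2 s : seq (K * K),
     forall t, t \in s -> I t.1 /\ J t.2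
   & x = \sum_(t <- s) t.1 * t.2].

Definition ideal_exp (I : set K) (n : nat) : set K :=
  iter n (ideal_mul I) ring_of_integers.

Definition ideal_dvd (I J : set K) : Prop :=
  exists2 C, is_ideal C & J = ideal_mul I C.

Definition radical (I : set K) : set K :=
  (\big[ideal_mul/ring_of_integers]_(P \in
      [set P | is_prime_ideal P /\ ideal_dvd P I]) P)%BIG.

(* The cardinality of the quotient of the ring of integers by I, witnessed by
   a complete system of representatives (0 if the quotient is infinite). *)
Definition ideal_norm (I : set K) : nat :=
  xget 0%N [set n | exists f : 'I_n -> K,
    (forall i, ring_of_integers (f i)) /\
    forall x, ring_of_integers x -> exists! i, I (x - f i)].

(* A non-Archimedean place of K is given by its normalized (surjective)
   discrete valuation; ordv v 0 is set to 0 by convention, so that distinct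
   elements of [place] are distinct places. *)
Record place := Place {
  ordv :> K -> int;
  ordv0 : ordv 0 = 0;
  ordvM : forall x y, x != 0 -> y != 0 -> ordv (x * y) = ordv x + ordv y;
  ordvD : forall x y, x != 0 -> y != 0 -> x + y != 0 ->
    Num.min (ordv x) (ordv y) <= ordv (x + y);
  ordv_surj : forall n : int, exists2 x, x != 0 & ordv x = n }.

HB.instance Definition _ := gen_eqMixin place.
HB.instance Definition _ := gen_choiceMixin place.

Definition valuation_ring (v : place) : set K := [set x | x = 0 \/ 0 <= v x].

Definition valuation_ideal (v : place) : set K := [set x | x = 0 \/ 0 < v x].

Definition prime_of_place (v : place) : set K :=
  ring_of_integers `&` valuation_ideal v.

Definition ideal_of_exponents (S : set place) (e : place -> nat) : set K :=
  (\big[ideal_mul/ring_of_integers]_(v \in S)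
      ideal_exp (prime_of_place v) (e v))%BIG.

End Ideals.

(* y^2 + a1 x y + a3 y = x^3 + a2 x^2 + a4 x + a6 *)
Record weierstrass (F : Type) := Weierstrass {
  wa1 : F; wa2 : F; wa3 : F; wa4 : F; wa6 : F }.

Definition map_weierstrass (F L : Type) (f : F -> L) (W : weierstrass F) :=
  Weierstrass (f (wa1 W)) (f (wa2 W)) (f (wa3 W)) (f (wa4 W)) (f (wa6 W)).

Section Weierstrass.
Variable F : fieldType.

Definition wdisc (W : weierstrass F) : F :=
  let: Weierstrass a1 a2 a3 a4 a6 := W in
  let b2 := a1 ^+ 2 + 4%:R * a2 in
  let b4 := 2%:R * a4 + a1 * a3 in
  let b6 := a3 ^+ 2 + 4%:R * a6 in
  let b8 := a1 ^+ 2 * a6 + 4%:R * a2 * a6 - a1 * a3 * a4 + a2 * a3 ^+ 2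
            - a4 ^+ 2 in
  - b2 ^+ 2 * b8 - 8%:R * b4 ^+ 3 - 27%:R * b6 ^+ 2 + 9%:R * b2 * b4 * b6.

(* W' is obtained from W by x = u^2 x' + r, y = u^3 y' + s u^2 x' + t. *)
Definition weierstrass_change (u r s t : F) (W W' : weierstrass F) : Prop :=
  let: Weierstrass a1 a2 a3 a4 a6 := W in
  [/\ u * wa1 W' = a1 + 2%:R * s,
      u ^+ 2 * wa2 W' = a2 - s * a1 + 3%:R * r - s ^+ 2,
      u ^+ 3 * wa3 W' = a3 + r * a1 + 2%:R * t,
      u ^+ 4 * wa4 W' = a4 - s * a3 + 2%:R * r * a2 - (t + r * s) * a1
                        + 3%:R * r ^+ 2 - 2%:R * s * t
    & u ^+ 6 * wa6 W' = a6 + r * a4 + r ^+ 2 * a2 + r ^+ 3 - t * a3 - t ^+ 2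
                        - r * t * a1].

Definition weierstrass_iso (W W' : weierstrass F) : Prop :=
  exists u r s t, u != 0 /\ weierstrass_change u r s t W W'.

(* (x, y) is on the affine curve and both partial derivatives vanish there.
   The point at infinity of a Weierstrass curve is never singular. *)
Definition singular_point (W : weierstrass F) (x y : F) : Prop :=
  let: Weierstrass a1 a2 a3 a4 a6 := W in
  [/\ y ^+ 2 + a1 * x * y + a3 * y = x ^+ 3 + a2 * x ^+ 2 + a4 * x + a6,
      a1 * y = 3%:R * x ^+ 2 + 2%:R * a2 * x + a4
    & 2%:R * y + a1 * x + a3 = 0].

(* The tangent cone at (x, y), Y^2 + a1 X Y - (3 x + a2) X^2, is a product
   (Y - m1 X) (Y - m2 X) with distinct slopes. *)
Definition node (W : weierstrass F) (x y : F) : Prop :=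
  singular_point W x y /\
  exists m1 m2, [/\ m1 != m2, m1 + m2 = - wa1 W
                  & m1 * m2 = - (3%:R * x + wa2 W)].

End Weierstrass.

Record elliptic_curve (F : fieldType) := EllipticCurve {
  ec_eqn :> weierstrass F;
  ec_disc_neq0 : wdisc ec_eqn != 0 }.

Section EllipticCurves.
Variable K : fieldExtType rat.

Definition weierstrass_integral (v : place K) (W : weierstrass K) : Prop :=
  [/\ valuation_ring v (wa1 W), valuation_ring v (wa2 W),
      valuation_ring v (wa3 W), valuation_ring v (wa4 W)
    & valuation_ring v (wa6 W)].

Definition ec_min_exponent (E : elliptic_curve K) (v : place K) : nat :=
  least [set n | exists W, [/\ weierstrass_iso E W, weierstrass_integral v W
                             & v (wdisc W) = n%:Z]].

Definition ec_min_disc (E : elliptic_curve K) : set K :=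
  ideal_of_exponents setT (ec_min_exponent E).

Definition minimal_equation (E : elliptic_curve K) (v : place K)
    (W : weierstrass K) : Prop :=
  [/\ weierstrass_iso E W, weierstrass_integral v W
    & v (wdisc W) = (ec_min_exponent E v)%:Z].

(* rho restricts to a ring morphism on the valuation ring whose kernel is the
   maximal ideal, i.e. it embeds the residue field at v into k; the values of
   rho outside the valuation ring are irrelevant. *)
Definition reduction_map (v : place K) (k : fieldType) (rho : K -> k) : Prop :=
  [/\ rho 1 = 1,
      forall x y, valuation_ring v x -> valuation_ring v y ->
        rho (x + y) = rho x + rho y,
      forall x y, valuation_ring v x -> valuation_ring v y ->
        rho (x * y) = rho x * rho y
    & forall x, valuation_ring v x -> (rho x = 0 <-> valuation_ideal v x)].

(* The reduced curve is examined over an algebraically closed extension k of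
   the residue field; the outcome does not depend on k, rho or W. *)
Definition good_reduction (E : elliptic_curve K) (v : place K) : Prop :=
  exists (k : closedFieldType) (rho : K -> k) (W : weierstrass K),
    [/\ reduction_map v rho, minimal_equation E v W
      & forall x y, ~ singular_point (map_weierstrass rho W) x y].

Definition multiplicative_reduction (E : elliptic_curve K) (v : place K) :
    Prop :=
  exists (k : closedFieldType) (rho : K -> k) (W : weierstrass K),
    [/\ reduction_map v rho, minimal_equation E v W
      & exists x y, node (map_weierstrass rho W) x y].

Definition semistable (E : elliptic_curve K) : Prop :=
  forall v, good_reduction E v \/ multiplicative_reduction E v.

End EllipticCurves.

(* A non-constant rational map P^1 -> P^1 over F is an element of F(x). *)
Notation ratmap F := {fraction {poly F}}.

Section RationalMaps.
Variable F : fieldType.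

Definition ratio_of (A B : {poly F}) : ratmap F :=
  FracField.tofrac A / FracField.tofrac B.

Definition lowest_terms (phi : ratmap F) (A B : {poly F}) : Prop :=
  [/\ B != 0, coprimep A B & phi = ratio_of A B].

Definition pair_degree (A B : {poly F}) : nat := (maxn (size A) (size B)).-1.

Definition has_degree (phi : ratmap F) (d : nat) : Prop :=
  exists A B, lowest_terms phi A B /\ pair_degree A B = d.

(* x^n P(1/x) *)
Definition recip (n : nat) (P : {poly F}) : {poly F} :=
  \poly_(i < n.+1) P`_(n - i).

(* In the coordinate u = 1/x the map A/B is u |-> N(u)/D(u) below. *)
Definition fixes_infinity (phi : ratmap F) (lambda : F) : Prop :=
  exists A B, lowest_terms phi A B /\
    let N := recip (pair_degree A B) B in
    let D := recip (pair_degree A B) A in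
    [/\ D.[0] != 0, N.[0] / D.[0] = 0
      & (N^`().[0] * D.[0] - N.[0] * D^`().[0]) / D.[0] ^+ 2 = lambda].

(* sigma o phi o sigma^-1 = psi for sigma(x) = alpha x + beta *)
Definition ratmap_iso (phi psi : ratmap F) : Prop :=
  exists alpha beta : F, alpha != 0 /\
  exists A B : {poly F},
    let sigmaV : {poly F} := alpha^-1 *: ('X - beta%:P) in
    [/\ B != 0, phi = ratio_of A B
      & psi = FracField.tofrac alpha%:P
              * ratio_of (A \Po sigmaV) (B \Po sigmaV)
              + FracField.tofrac beta%:P].

Definition standard_form (d : nat) (lambda : F) (A B : {poly F}) : Prop :=
  [/\ A \is monic, size A = d.+1, size B = d & lead_coef B = lambda].

Definition wronskian (A B : {poly F}) : {poly F} := B * A^`() - A * B^`().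

(* The fibre of A/B through z has z as a point of multiplicity at least 2. *)
Definition ramified (A B : {poly F}) (z : F) : bool :=
  ('X - z%:P) ^+ 2 %| B.[z] *: A - A.[z] *: B.

End RationalMaps.

(* a^(2N-2) prod_(m<n) (r_m - r_n)^2 for P = a prod_n (x - r_n) *)
Definition poly_disc (L : closedFieldType) (P : {poly L}) : L :=
  let r := sval (closed_field_poly_normal P) in
  lead_coef P ^+ (2 * size r - 2) *
  \prod_(n < size r) \prod_(m < size r | (m < n)%N) (r`_m - r`_n) ^+ 2.

(* Kbar plays the role of an algebraic closure of K; that it is algebraic over
   K is not needed for the definitions. *)
Section CriticalDiscriminant.
Variables (K : fieldExtType rat) (Kbar : closedFieldType).
Variable iota : {rmorphism K -> Kbar}.

(* None is the point at infinity. *)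
Definition critical_point (A B : {poly K}) (P : option Kbar) : bool :=
  if P is Some z then ramified (map_poly iota A) (map_poly iota B) z
  else ramified (map_poly iota (recip (pair_degree A B) A))
                (map_poly iota (recip (pair_degree A B) B)) 0.

Definition critically_separable (d : nat) (phi : ratmap K) : Prop :=
  exists A B, lowest_terms phi A B /\
  exists s : seq (option Kbar),
    [/\ uniq s, size s = (2 * d - 2)%N
      & forall P, (P \in s) = critical_point A B P].

Definition critical_family (d : nat) (lambda : K) : set (ratmap K) :=
  [set phi | [/\ has_degree phi d, critically_separable d phi,
                 fixes_infinity phi lambda
   & exists A B, [/\ lowest_terms phi A B, standard_form d lambda A B
     & A`_d.-1 = (d%:R - lambda) / (d.-1%:R * lambda) * B`_d.-2]]].

(* The discriminant of the Wronskian, taken in Kbar, lies in K. *)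
Definition critical_disc (A B : {poly K}) : K :=
  xget 0 [set D | iota D = poly_disc (map_poly iota (wronskian A B))].

Definition critical_min_exponent (d : nat) (lambda : K) (phi : ratmap K)
    (v : place K) : nat :=
  least [set n | exists A B,
    [/\ standard_form d lambda A B,
        forall i, valuation_ring v A`_i /\ valuation_ring v B`_i,
        ratmap_iso phi (ratio_of A B)
      & v (critical_disc A B) = n%:Z]].

Definition critical_min_disc (d : nat) (lambda : K) (phi : ratmap K) : set K :=
  ideal_of_exponents [set v | valuation_ring v lambda]
    (critical_min_exponent d lambda phi).

End CriticalDiscriminant.

(* Main.v *)
Require Import Defs.
From mathcomp Require Import all_boot all_order all_algebra all_field.
From mathcomp Require Import boolp classical_sets functions cardinality fsbigop.
From mathcomp Require Import reals exp.
From mathcomp Require Import ring zify.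

(** The x-coordinate of 2P on an elliptic curve E is a rational function of
    degree 4 of the x-coordinate of P, which fixes infinity with multiplier 4.
    This duplication map phi_E has critical points at the x-coordinates of the
    twelve points of exact order 4, hence six distinct ones, and so it belongs
    to the critical family of degree 4 and multiplier 4 (dup_family).  The whole
    proof consists in comparing the critical discriminant of phi_E with the
    discriminant of E.

    Writing the critical points in terms of the abscissas e_1, e_2, e_3 of the
    points of order 2, one finds that the discriminant of the Wronskian is
    - 2^18 D^5, where D is the discriminant of the Weierstrass equation
    (dup_poly_disc).  A substitution x -> al x + be turns the duplication map
    of one curve into that of a quadratic twist, multiplying c4 by al^2 and D by
    al^6 (conj_c4, conj_disc).  Let v be a finite place and let d(E), d(phi) be
    the two minimal exponents at v.  Then:

    - 5 d(E) <= d(phi).  If E has good reduction then d(E) = 0.  If it has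
      multiplicative reduction, c4 is a unit at v for the minimal equation
      (node_c4_unit).  For any integral pair (A, B) conjugate to phi_E, the
      number al^2 c4 is an integral polynomial in the coefficients of B, so al
      is integral at v and the discriminant cannot drop (crit_values_ge).
    - d(phi) <= 18 v(2) + 5 d(E), so that d(phi) > 0 implies d(E) > 0 or v | 2.

    Taking norms, N(Delta(E))^5 <= N(Delta(phi_E)), while the norm of the radical
    of Delta(phi_E) is at most that of Delta(E) times the norm M of the product
    of the primes above 2 (global_comparison).  Since 30 = 5 * 6, the bound for
    phi_E with 5 eps in place of eps gives the bound for E with eps.

    To take norms, ideals are described by valuations: J(e) is the set of
    integers x of K with v(x) >= e(v) for all v.  The arithmetic of
    these ideals rests on two facts.  The residue rings O / m O are finite
    (covers_neq0), because integers of K that are independent modulo a prime p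
    are linearly independent over the rationals.  The valuation ring of a place
    is the localization of O at its prime (unit_denominator), by descent on the
    degree of a primitive integral equation.  Finiteness makes the primes of
    places maximal and invertible; hence P_w J(e) = J(e + w) (mul_prime), the
    quotient J(e) / J(e + w) has as many elements as O / P_w
    (residue_system_mul), and the norm and the radical of J(e) can be read off
    e (ideal_norm_exponents, radicalE). *)

Set Implicit Arguments.
Unset Strict Implicit.
Unset Printing Implicit Defensive.
Import Order.TTheory GRing.Theory Num.Theory.
Local Open Scope classical_set_scope.
Local Open Scope ring_scope.

(** * Valuations *)

Section Valuation.
Variables (K : fieldExtType rat) (v : place K).

(** The order of 0 is infinite, whatever the conventional value v 0. *)
Definition vge (n : int) (x : K) : Prop := x = 0 \/ n <= v x.

Lemma vge_neq0 n x : x != 0 -> vge n x -> n <= v x.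
Proof. by move=> /eqP x0 []. Qed.

Lemma ordv1 : v 1 = 0.
Proof.
have := ordvM v (oner_neq0 K) (oner_neq0 K); rewrite mulr1 => h.
by apply: (addrI (v 1)); rewrite addr0 -h.
Qed.

Lemma ordvN1 : v (-1) = 0.
Proof.
have n1 : (-1 : K) != 0 by rewrite oppr_eq0 oner_neq0.
have := ordvM v n1 n1; rewrite mulrNN mulr1 ordv1 => h; lia.
Qed.

Lemma ordvX x n : x != 0 -> v (x ^+ n) = v x * n%:Z.
Proof.
move=> x0; elim: n => [|n IH]; first by rewrite expr0 ordv1 mulr0.
rewrite exprS ordvM ?expf_neq0 // IH; lia.
Qed.

Lemma ordvV x : x != 0 -> v x^-1 = - v x.
Proof.
move=> x0; have := ordvM v x0 (invr_neq0 x0); rewrite divff // ordv1; lia.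
Qed.

Lemma vge0 n : vge n 0. Proof. by left. Qed.

Lemma vge1 : vge 0 1. Proof. by right; rewrite ordv1. Qed.

Lemma vgeM n m x y : vge n x -> vge m y -> vge (n + m) (x * y).
Proof.
have [->|x0] := eqVneq x 0; first by rewrite mul0r; left.
have [->|y0] := eqVneq y 0; first by rewrite mulr0; left.
move=> /(vge_neq0 x0) hx /(vge_neq0 y0) hy; right.
by rewrite ordvM // lerD.
Qed.

Lemma vgeM0 n x y : vge 0 x -> vge n y -> vge n (x * y).
Proof. by move=> hx /(vgeM hx); rewrite add0r. Qed.

Lemma vgeD n x y : vge n x -> vge n y -> vge n (x + y).
Proof.
have [->|x0] := eqVneq x 0; first by rewrite add0r.
have [->|y0] := eqVneq y 0; first by rewrite addr0.
move=> /(vge_neq0 x0) hx /(vge_neq0 y0) hy.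
have [->|xy0] := eqVneq (x + y) 0; first by left.
right; apply: le_trans (ordvD v x0 y0 xy0); by rewrite le_min hx hy.
Qed.

Lemma vgeN n x : vge n x -> vge n (- x).
Proof. by rewrite -mulN1r; apply: vgeM0; right; rewrite ordvN1. Qed.

Lemma vgeB n x y : vge n x -> vge n y -> vge n (x - y).
Proof. by move=> hx /vgeN; apply: vgeD. Qed.

Lemma vgeW n m x : m <= n -> vge n x -> vge m x.
Proof. by move=> mn [->|h]; [left|right; apply: le_trans h]. Qed.

Lemma vge_sum I (r : seq I) (P : pred I) (F : I -> K) n :
  (forall i, P i -> vge n (F i)) -> vge n (\sum_(i <- r | P i) F i).
Proof.
move=> h; elim/big_ind: _ => //; [exact: vge0 | by move=> *; apply: vgeD].
Qed.

Lemma vgeX x n : vge 0 x -> vge 0 (x ^+ n).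
Proof.
move=> hx; elim: n => [|n IH]; first by rewrite expr0; apply: vge1.
by rewrite exprS; apply: vgeM0.
Qed.

Lemma vge_nat n : vge 0 n%:R.
Proof.
elim: n => [|n IH]; first exact: vge0.
by rewrite -addn1 natrD; apply: vgeD => //; apply: vge1.
Qed.

Lemma vge_int m : vge 0 m%:~R.
Proof. by case: m => n; [|apply: vgeN]; apply: vge_nat. Qed.

Lemma unit_of_vge x : vge 0 x -> ~ vge 1 x -> x != 0 /\ v x = 0.
Proof.
move=> h0 h1; have x0 : x != 0 by apply/eqP => e; apply: h1; left.
split=> //; have := vge_neq0 x0 h0.
have : ~~ (1 <= v x) by apply/negP => h; apply: h1; right.
lia.
Qed.

(** In a monic equation of a non-integral element at v, the leading term would
    have strictly smaller valuation than all the others. *)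
Lemma integral_vge0 x : ring_of_integers x -> vge 0 x.
Proof.
case=> p mon_p px0.
have [->|x0] := eqVneq x 0; first exact: vge0.
right; rewrite leNgt; apply/negP => vx.
have hy : vge 1 x^-1 by right; rewrite ordvV //; lia.
have sp : size (map_poly (intr : int -> K) p) = size p.
  by rewrite size_map_poly_id0 // (monicP mon_p) rmorph1 oner_neq0.
have [n sn] : exists n, size p = n.+1.
  by exists (size p).-1; rewrite prednK // lt0n size_poly_eq0 monic_neq0.
have xn0 : x ^+ n != 0 by rewrite expf_neq0.
have : vge 1 (1 : K); last first.
  by case=> [/eqP|]; [rewrite oner_eq0 | rewrite ordv1].
have -> : 1 = - \sum_(i < n) (p`_i)%:~R * (x ^+ i / x ^+ n).
  apply/eqP; rewrite -subr_eq0 opprK addrC; apply/eqP.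
  have := px0; rewrite /root horner_coef sp sn big_ord_recr /=.
  have -> : (map_poly (intr : int -> K) p)`_n = 1.
    have := monicP mon_p; rewrite lead_coefE sn /= => e.
    by rewrite coef_map /= e rmorph1.
  move=> /eqP h; apply: (mulIf xn0); rewrite mul0r mulrDl mul1r -[RHS]h mul1r.
  congr (_ + _); rewrite mulr_suml; apply: eq_bigr => i _.
  by rewrite coef_map /= mulrA divfK.
apply: vgeN; apply: vge_sum => i _; apply: vgeM0; first exact: vge_int.
have -> : x ^+ i / x ^+ n = x^-1 ^+ (n - i).-1 * x^-1.
  rewrite -exprSr prednK ?subn_gt0 // exprVn.
  have {2}-> : n = (i + (n - i))%N by rewrite subnKC // ltnW.
  by rewrite exprD invfM mulrA divff ?mul1r // expf_neq0.
by apply: vgeM0 (hy); apply: vgeX; apply: vgeW hy.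
Qed.

End Valuation.

Section RingOfIntegers.
Variable K : fieldExtType rat.
Local Notation O := (@ring_of_integers K).

Lemma roi0 : O 0. Proof. exact: (@integral0 _ _ intr). Qed.
Lemma roi1 : O 1. Proof. exact: (@integral1 _ _ intr). Qed.
Lemma roiD x y : O x -> O y -> O (x + y). Proof. exact: (@integral_add _ _ intr). Qed.
Lemma roiB x y : O x -> O y -> O (x - y). Proof. exact: (@integral_sub _ _ intr). Qed.
Lemma roiM x y : O x -> O y -> O (x * y). Proof. exact: (@integral_mul _ _ intr). Qed.
Lemma roi_int m : O m%:~R. Proof. exact: (@integral_id _ _ intr m). Qed.
Lemma roiX x n : O x -> O (x ^+ n).
Proof. by move=> h; elim: n => [|n IH]; [exact: roi1 | rewrite exprS; apply: roiM]. Qed.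
Lemma roi_sum I (r : seq I) (P : pred I) (F : I -> K) :
  (forall i, P i -> O (F i)) -> O (\sum_(i <- r | P i) F i).
Proof. by move=> h; elim/big_ind: _ => //; [exact: roi0 | apply: roiD]. Qed.

End RingOfIntegers.

(** * Integral relations and finiteness of residue rings *)

(** The least positive integral combination g of the family divides each of its
    members, since a nonzero remainder would be a smaller combination. *)
Lemma bezout_family m (a : 'I_m -> int) : (exists i, a i != 0) ->
  exists (g : int) (e : 'I_m -> int),
    [/\ g != 0, \sum_i e i * a i = g & forall i, (g %| a i)%Z].
Proof.
move=> [i0 ai0].
pose comb (n : nat) := `[< (0 < n)%N /\ exists e : 'I_m -> int,
  \sum_i e i * a i = n%:Z >].
have ex : exists n, comb n.
  exists (absz (\sum_i a i * a i)); apply/asboolP.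
  have sq : 0 < \sum_i a i * a i.
    rewrite (bigD1 i0) //=; apply: ltr_pwDl.
      by rewrite -expr2 exprn_even_gt0.
    by apply: sumr_ge0 => i _; rewrite -expr2 sqr_ge0.
  split; first by rewrite absz_gt0 gt_eqF.
  by exists a; rewrite gez0_abs // ltW.
case: (ex_minnP ex) => g /asboolP[g0 [e he]] gmin.
exists g%:Z, e; split=> // [|j]; first by rewrite eqz_nat -lt0n.
have gz : g%:Z != 0 by rewrite eqz_nat -lt0n.
apply/dvdz_mod0P/eqP; apply: contraT => r0.
have rge := modz_ge0 (a j) gz.
have rlt : (a j %% g)%Z < g by rewrite ltz_pmod // ltz_nat.
suff /gmin : comb (absz (a j %% g)%Z) by lia.
apply/asboolP; split; first by rewrite absz_gt0.
exists (fun i => (i == j)%:Z - (a j %/ g)%Z * e i).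
rewrite gez0_abs //.
under eq_bigr do rewrite mulrBl -mulrA.
rewrite sumrB -mulr_sumr he (bigD1 j) //= eqxx mul1r big1 ?addr0; last first.
  by move=> i /negPf->; rewrite mul0r.
by rewrite {1}(divz_eq (a j) g); ring.
Qed.

Section Relations.
Variable K : fieldExtType rat.
Local Notation O := (@ring_of_integers K).

Lemma intrK_eq0 (m : int) : (m%:~R == 0 :> K) = (m == 0).
Proof.
have -> : m%:~R = (m%:~R : rat) *: (1 : K) by rewrite scaler_int.
by rewrite scaler_eq0 oner_eq0 orbF intr_eq0.
Qed.

Lemma natrK_eq0 (m : nat) : (m%:R == 0 :> K) = (m == 0)%N.
Proof. exact: (intrK_eq0 m%:Z). Qed.

(** A rational relation is cleared of denominators and divided by its gcd.  The
    coefficients e witness that the result does not vanish modulo any prime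
    or place, so that it survives reduction. *)
Lemma primitive_relation m (x : 'I_m -> K) : (\dim {:K} < m)%N ->
  exists a e : 'I_m -> int,
    \sum_i (a i)%:~R * x i = 0 /\ \sum_i e i * a i = 1.
Proof.
move=> dm; pose X := [tuple x i | i < m].
have : ~~ free X.
  apply: contraL dm => fX; rewrite -leqNgt -{1}(size_tuple X).
  by move: fX; rewrite /free => /eqP <-; apply: dimvS; apply: subvf.
move=> /freeP nf.
have [k [hk [i0 ki0]]] : exists k : 'I_m -> rat,
    \sum_i k i *: x i = 0 /\ exists i, k i != 0.
  apply: contrapT => h; apply: nf => k hk i; apply/eqP.
  apply: contraT => ki; exfalso; apply: h; exists k; split; last by exists i.
  rewrite -[RHS]hk; apply: eq_bigr => j _.
  by rewrite (nth_map j) ?nth_ord_enum ?size_enum_ord // nth_mktuple.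
pose n i : int := numq (k i) * \prod_(j | j != i) denq (k j).
pose D : int := \prod_i denq (k i).
have D0 : D != 0 by apply/prodf_neq0 => i _; apply: denq_neq0.
have nE i : (n i)%:~R = D%:~R * k i :> rat.
  have -> : D = denq (k i) * \prod_(j | j != i) denq (k j) by rewrite /D (bigD1 i).
  rewrite /n !intrM.
  by rewrite -{3}(divq_num_den (k i)); field; rewrite intr_eq0 denq_neq0.
have n0 : exists i, n i != 0.
  exists i0; rewrite -(intr_eq0 rat) nE mulf_eq0 intr_eq0 (negPf D0) /=.
  exact: ki0.
have hn : \sum_i (n i)%:~R * x i = 0.
  have : D%:~R *: (\sum_i k i *: x i) = 0 by rewrite hk scaler0.
  rewrite scaler_sumr => h; rewrite -[RHS]h; apply: eq_bigr => i _.
  by rewrite scalerA -nE scaler_int mulrzl.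
have [g [e [g0 he hd]]] := bezout_family n0.
exists (fun i => (n i %/ g)%Z), e; split.
  have gK : g%:~R != 0 :> K by rewrite intrK_eq0.
  apply: (mulfI gK); rewrite mulr0 mulr_sumr -[RHS]hn.
  apply: eq_bigr => i _; rewrite mulrA -intrM; congr (_%:~R * _).
  by rewrite mulrC divzK.
apply: (mulIf g0); rewrite mul1r -[RHS]he mulr_suml.
by apply: eq_bigr => i _; rewrite -mulrA divzK.
Qed.

(** Multiplying by a power of the leading coefficient c turns the equation of
    y into a monic equation of c * y. *)
Lemma lead_mul_integral n (a : nat -> K) y : (forall i, O (a i)) ->
  \sum_(i < n.+2) a i * y ^+ i = 0 -> O (a n.+1 * y).
Proof.
move=> Oa; rewrite big_ord_recr /= => h; set c := a n.+1.
pose q : {poly K} := \poly_(i < n.+1) (a i * c ^+ (n - i)).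
pose p : {poly K} := 'X^(n.+1) + q.
have sq : (size q <= n.+1)%N by apply: size_poly.
have mon : p \is monic.
  by rewrite monicE lead_coefDl ?lead_coefXn // size_polyXn ltnS.
apply: (integral_root_monic mon).
  rewrite /root /p hornerD hornerXn horner_poly; apply/eqP.
  have : c ^+ n * (\sum_(i < n.+1) a i * y ^+ i + c * y ^+ n.+1) = 0.
    by rewrite h mulr0.
  rewrite mulrDr addrC mulrA -exprSr -exprMn => h'.
  rewrite -[RHS]h'; congr (_ + _); rewrite mulr_sumr; apply: eq_bigr => i _.
  have -> : c ^+ n = c ^+ (n - i) * c ^+ i by rewrite -exprD subnK // -ltnS.
  by rewrite exprMn; ring.
apply/(integral_poly (intr : int -> K)) => i; rewrite /p coefD coefXn coef_poly.
apply: roiD; first by case: eqP => _; [exact: roi1 | exact: roi0].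
by case: ifP => _; [apply: roiM => //; apply: roiX; apply: Oa | exact: roi0].
Qed.

(** The last nonzero coefficient of an integral relation between the powers of
    y is such a denominator. *)
Lemma integer_denominator (y : K) : exists2 N : int, N != 0 & O (N%:~R * y).
Proof.
have [a [e [ha he]]] := primitive_relation (fun i : 'I_(\dim {:K}).+1 => y ^+ i)
  (ltnSn _).
pose b (n : nat) : int := if insub n is Some i then a i else 0.
have bE (i : 'I_(\dim {:K}).+1) : b i = a i.
  by rewrite /b valK.
have b0 : exists2 i, (i < (\dim {:K}).+1)%N & b i != 0.
  apply: contrapT => h; suff : (1 : int) = 0 by [].
  rewrite -he big1 // => i _; rewrite -bE; apply/eqP; rewrite mulf_eq0.
  apply/orP; right; apply: contraT => bi; exfalso; apply: h.
  by exists i; first exact: ltn_ord.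
have {ha} : \sum_(i < (\dim {:K}).+1) (b i)%:~R * y ^+ i = 0.
  by rewrite -[RHS]ha; apply: eq_bigr => i _; rewrite bE.
elim: _.+1 b0 => [|n IH] [i]; first by [].
rewrite ltnS leq_eqVlt => /orP[/eqP -> | lin] bi hs.
  case: n {IH} bi hs => [|n] bi hs.
    move: hs; rewrite big_ord1 expr0 mulr1 => /eqP; rewrite intrK_eq0.
    by rewrite (negPf bi).
  exists (b n.+1) => //.
  exact: (@lead_mul_integral n (fun i => (b i)%:~R) y (fun i => roi_int _ (b i)) hs).
have [bn|bn] := eqVneq (b n) 0.
  by apply: IH; [exists i | move: hs; rewrite big_ord_recr /= bn mul0r addr0].
case: n {IH} lin bn hs => [//|n] lin bn hs.
exists (b n.+1) => //.
exact: (@lead_mul_integral n (fun i => (b i)%:~R) y (fun i => roi_int _ (b i)) hs).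
Qed.

(** Every class modulo m has a representative in L; divisibility by m in the
    ring of integers is expressed by a division in K. *)
Definition covers_mod (m : K) (L : seq K) :=
  (forall l, l \in L -> O l) /\ forall x, O x -> exists2 l, l \in L & O ((x - l) / m).

(** A family of integers of K that is independent modulo p is independent over
    the rationals, because a rational relation can be made primitive; hence a
    maximal such family exists, and its combinations with coefficients below p
    represent all residue classes. *)
Lemma covers_prime p : prime p -> exists L, covers_mod p%:R L.
Proof.
move=> pp; have p0 : (p%:R : K) != 0.
  by rewrite natrK_eq0 -lt0n prime_gt0.
have pz : p%:Z != 0 by rewrite eqz_nat -lt0n prime_gt0.
pose indep r (x : 'I_r -> K) := (forall i, O (x i)) /\
  forall c : 'I_r -> int, O ((\sum_i (c i)%:~R * x i) / p%:R) ->
    forall i, (p %| c i)%Z.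
pose P r := `[< exists x : 'I_r -> K, indep r x >].
have exP : exists r, P r.
  exists 0%N; apply/asboolP; exists (fun=> 0); split; first by case.
  by move=> c _; case.
have bP r : P r -> (r <= \dim {:K})%N.
  move=> /asboolP[x [Ox hx]]; rewrite leqNgt; apply/negP => dr.
  have [a [e [ha he]]] := primitive_relation x dr.
  have pa : forall i, (p %| a i)%Z.
    by apply: hx; rewrite ha mul0r; apply: roi0.
  have : (p %| 1%R)%Z by rewrite -he; apply: rpred_sum => i _; apply: dvdz_mull.
  by rewrite dvdzE /= dvdn1 => /eqP p1; rewrite p1 in pp.
case: (ex_maxnP exP bP) => r /asboolP[x [Ox hx]] rmax.
exists [seq \sum_i (f i : nat)%:R * x i | f : {ffun 'I_r -> 'I_p}]; split.
  move=> l /mapP[f _ ->]; apply: roi_sum => i _; apply: roiM (Ox i).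
  exact: (roi_int K (f i : nat)%:Z).
move=> y Oy; pose x' (i : 'I_r.+1) := oapp x y (unlift ord0 i).
have x'0 : x' ord0 = y by rewrite /x' unlift_none.
have x'S i : x' (lift ord0 i) = x i by rewrite /x' liftK.
have : ~ indep r.+1 x'.
  move=> h; have /rmax : P r.+1 by apply/asboolP; exists x'.
  by rewrite ltnn.
move=> nind.
have [c [hc [j /negP pj]]] : exists c : 'I_r.+1 -> int,
    O ((\sum_i (c i)%:~R * x' i) / p%:R) /\ exists i, ~ (p %| c i)%Z.
  apply: contrapT => h; apply: nind; split.
    by move=> i; rewrite /x'; case: unliftP => [k _|_] /=.
  by move=> c hc i; apply: contrapT => pi; apply: h; exists c; split => //; exists i.
have hc' : O (((c ord0)%:~R * y + \sum_i (c (lift ord0 i))%:~R * x i) / p%:R).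
  move: hc; rewrite big_ord_recl x'0.
  by under eq_bigr do rewrite x'S.
have pc0 : ~~ (p %| c ord0)%Z.
  apply: contra pj => /dvdzP[k ck].
  have : forall i, (p %| c (lift ord0 i))%Z.
    apply: (hx (fun i => c (lift ord0 i))).
    have := roiB hc' (roiM (roi_int K k) Oy); rewrite ck.
    congr (O _); rewrite intrM; field; exact: p0.
  case: (unliftP ord0 j) => [i ->|->]; first exact.
  by move=> _; apply/dvdzP; exists k.
have [u [t ut]] : exists u t : int, u * c ord0 + t * p = 1.
  have cop : coprimez (c ord0) p.
    by rewrite coprimez_sym coprimezE prime_coprime.
  by have [u [v h]] := Bezoutz (c ord0) p; exists u, v; rewrite h (eqP cop).
pose b i : int := ((- u * c (lift ord0 i)) %% p)%Z.
have b_lt i : (`|b i| < p)%N.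
  have := modz_ge0 (- u * c (lift ord0 i)) pz.
  have : (b i < p)%R by rewrite ltz_pmod // ltz_nat prime_gt0.
  rewrite -/(b i); lia.
exists (\sum_i (`|b i|%N)%:R * x i).
  apply/mapP; exists [ffun i => Ordinal (b_lt i)]; first by rewrite mem_enum.
  by apply: eq_bigr => i _; rewrite ffunE.
pose k i : int := ((- u * c (lift ord0 i)) %/ p)%Z.
have bZ i : b i = - u * c (lift ord0 i) - k i * p%:Z.
  by have := divz_eq (- u * c (lift ord0 i)) p; rewrite -/(b i) -/(k i) => ->; ring.
have bE i : (`|b i|%N)%:R = - u%:~R * (c (lift ord0 i))%:~R - (k i)%:~R * p%:R :> K.
  have -> : (`|b i|%N)%:R = (b i)%:~R :> K.
    by rewrite -[in RHS](gez0_abs (modz_ge0 _ pz : 0 <= b i)).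
  by rewrite bZ rmorphB !rmorphM rmorphN.
have := roiD (roiD (roiM (roi_int K u) hc') (roiM (roi_int K t) Oy))
  (roi_sum (index_enum _) (P := xpredT) (fun i _ => roiM (roi_int K (k i)) (Ox i))).
congr (O _).
have -> : \sum_i (`|b i|%N)%:R * x i =
   - u%:~R * (\sum_i (c (lift ord0 i))%:~R * x i) - p%:R * \sum_i (k i)%:~R * x i.
  rewrite !mulr_sumr -sumrB; apply: eq_bigr => i _; rewrite bE; ring.
have yE : y = u%:~R * (c ord0)%:~R * y + t%:~R * p%:R * y.
  by rewrite -mulrDl -[p%:R]/(p%:Z%:~R) -!intrM -intrD ut mul1r.
rewrite [in RHS]yE; field; exact: p0.
Qed.

Lemma covers_nat m : (0 < m)%N -> exists L, covers_mod m%:R L.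
Proof.
elim/ltn_ind: m => m IH m0.
have [m1|m1] := leqP m 1.
  have -> : m = 1%N by lia.
  exists [:: 0]; split; first by move=> l; rewrite inE => /eqP->; apply: roi0.
  by move=> x Ox; exists 0; rewrite ?inE // subr0 divr1.
have pp := pdiv_prime m1; have p0 := prime_gt0 pp.
have mE : m = (pdiv m * (m %/ pdiv m))%N by rewrite mulnC divnK // pdiv_dvd.
have m'0 : (0 < m %/ pdiv m)%N by rewrite divn_gt0 // pdiv_leq.
have m'lt : (m %/ pdiv m < m)%N by rewrite ltn_Pdiv // prime_gt1.
have [L1 [O1L h1]] := covers_prime pp.
have [L2 [O2L h2]] := IH _ m'lt m'0.
set p := pdiv m in mE p0 h1 *; set q := (m %/ p)%N in mE m'0 h2 *.
exists [seq a + p%:R * b | a <- L1, b <- L2]; split.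
  move=> l /allpairsP[[a b] /= [ha hb ->]].
  by apply: roiD; [exact: O1L | apply: roiM; [exact: (roi_int K p%:Z) | exact: O2L]].
move=> x Ox; have [a ha Oa] := h1 _ Ox; have [b hb Ob] := h2 _ Oa.
exists (a + p%:R * b); first by apply/allpairsP; exists (a, b).
move: Ob; congr (O _); rewrite mE natrM; field.
by rewrite !natrK_eq0 -!lt0n m'0 p0.
Qed.

(** The element x divides a nonzero rational integer. *)
Lemma covers_neq0 x : O x -> x != 0 -> exists L, covers_mod x L.
Proof.
move=> Ox x0; have [N N0 ON] := integer_denominator x^-1.
have [L [OL hL]] := @covers_nat `|N|%N (ltac:(by rewrite absz_gt0)).
exists L; split=> // y Oy; have [l lL Ol] := hL _ Oy; exists l => //.
have N0K : (`|N|%N)%:R != 0 :> K by rewrite natrK_eq0 absz_eq0.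
have OA : O ((`|N|%N)%:R / x).
  case: (lerP 0 N) => hN.
    by have -> : (`|N|%N)%:R = N%:~R :> K by rewrite -[in RHS](gez0_abs hN).
  have -> : (`|N|%N)%:R = - N%:~R :> K by rewrite -[in RHS](opprK N) -(ltz0_abs hN) rmorphN opprK.
  by rewrite mulNr -sub0r; apply: roiB => //; apply: roi0.
have := roiM Ol OA; congr (O _); field; by rewrite x0 N0K.
Qed.

End Relations.

(** * The primes of places *)

Section Places.
Variable K : fieldExtType rat.
Local Notation O := (@ring_of_integers K).
Implicit Types v w : place K.

Lemma nvge1 w : ~ vge w 1 (1 : K).
Proof. by case=> [/eqP|]; rewrite ?oner_eq0 // ordv1. Qed.

Lemma denominator_descent w (y : K) n (a : nat -> K) :
  vge w 0 y -> (forall i, O (a i)) -> \sum_(i < n.+1) a i * y ^+ i = 0 ->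
  (exists2 i, (i <= n)%N & ~ vge w 1 (a i)) ->
  exists u, [/\ O u, ~ vge w 1 u & O (u * y)].
Proof.
move=> hy; elim: n a => [|n IH] a Oa hs [i lin hi].
  case: hi; move: lin hs; rewrite leqn0 big_ord1 mulr1 => /eqP-> ->; left.
  by [].
have Ocy := lead_mul_integral Oa hs.
have [hc|hc] := pselect (vge w 1 (a n.+1)); last by exists (a n.+1).
apply: (IH (fun i => if i == n then a n + a n.+1 * y else a i)).
- by move=> j; case: eqP => _ //; apply: roiD.
- move: hs; rewrite !big_ord_recr /= eqxx exprS => h; rewrite -[RHS]h.
  rewrite mulrDl mulrA addrA; congr (_ + _ + _); apply: eq_bigr => j _.
  by rewrite ltn_eqF.
exists i.
  by move: lin; rewrite leq_eqVlt => /orP[/eqP ein|//]; rewrite ein in hi.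
case: eqP => // ein; rewrite ein in hi => h; apply: hi.
rewrite -[a n](addrK (a n.+1 * y)); apply: vgeB => //.
by rewrite mulrC; apply: vgeM0.
Qed.

(** The valuation ring at w is the localization of the ring of integers: if
    the leading coefficient c of a primitive integral equation of y is not a
    denominator prime to w, then c * y is integral and c vanishes at w, so that
    the equation can be shortened without losing its coefficient prime to w. *)
Lemma unit_denominator w y : vge w 0 y ->
  exists u, [/\ O u, ~ vge w 1 u & O (u * y)].
Proof.
move=> hy.
have [a [e [ha he]]] := primitive_relation (fun i : 'I_(\dim {:K}).+1 => y ^+ i)
  (ltnSn _).
pose b (n : nat) : K := if insub n is Some i then (a i)%:~R else 0.
have bE (i : 'I_(\dim {:K}).+1) : b i = (a i)%:~R by rewrite /b valK.
apply: (denominator_descent (n := \dim {:K}) (a := b) hy).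
- by move=> i; rewrite /b; case: insub => [j|]; [exact: roi_int | exact: roi0].
- by rewrite -[RHS]ha; apply: eq_bigr => i _; rewrite bE.
apply: contrapT => h.
apply: (@nvge1 w).
have -> : (1 : K) = \sum_i (e i)%:~R * (a i)%:~R.
  by rewrite -[LHS]/(1%:~R) -he rmorph_sum /=; apply: eq_bigr => i _; rewrite intrM.
apply: vge_sum => i _; apply: vgeM0; first exact: vge_int.
apply: contrapT => hi; apply: h; exists i; last by rewrite bE.
by rewrite -ltnS ltn_ord.
Qed.

Lemma uniformizer w : exists p, [/\ O p, p != 0 & w p = 1].
Proof.
have [y y0 wy] := ordv_surj w 1.
have [u [Ou hu Ouy]] : exists u, [/\ O u, ~ vge w 1 u & O (u * y)].
  by apply: unit_denominator; right; rewrite wy.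
have [u0 wu] := unit_of_vge (integral_vge0 w Ou) hu.
by exists (u * y); rewrite mulf_neq0 // ordvM // wu wy add0r.
Qed.

Lemma nvge1M w x y : vge w 0 x -> vge w 0 y -> vge w 1 (x * y) ->
  vge w 1 x \/ vge w 1 y.
Proof.
move=> hx hy hxy; have [?|nx] := pselect (vge w 1 x); first by left.
right; apply: contrapT => ny.
have [x0 vx] := unit_of_vge hx nx; have [y0 vy] := unit_of_vge hy ny.
have := vge_neq0 (mulf_neq0 x0 y0) hxy.
by rewrite ordvM // vx vy.
Qed.

Lemma vge1X w x n : vge w 0 x -> vge w 1 (x ^+ n) -> vge w 1 x.
Proof.
move=> hx; elim: n => [/nvge1//|n IH]; rewrite exprS => /nvge1M[] //.
exact: vgeX.
Qed.

(** By pigeonhole two powers of u agree in the finite residue ring. *)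
Lemma prime_maximal w u : O u -> ~ vge w 1 u ->
  exists2 a, O a & vge w 1 (1 - a * u).
Proof.
move=> Ou hu; have [p [Op p0 wp]] := uniformizer w.
have [L [OL hL]] := covers_neq0 Op p0.
have ex i : exists l, (l < size L)%N && `[< O ((u ^+ i - L`_l) / p) >].
  have [l lL Ol] := hL _ (roiX i Ou).
  by exists (index l L); rewrite index_mem lL; apply/asboolP; rewrite nth_index.
have fP i := xchooseP (ex i).
have flt (i : 'I_(size L).+1) : (xchoose (ex i) < size L)%N by case/andP: (fP i).
pose f i := Ordinal (flt i).
have [i [j [ij fij]]] : exists i j : 'I_(size L).+1, (i < j)%N /\ f i = f j.
  apply: contrapT => h.
  have : injective f.
    move=> i j fij; apply/val_inj; case: (ltngtP i j) => // ij.
      by case: h; exists i, j.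
    by case: h; exists j, i.
  by move=> /leq_card; rewrite !card_ord ltnn.
have Od : O ((u ^+ i - u ^+ j) / p).
  have /andP[_ /asboolP hi] := fP i; have /andP[_ /asboolP hj] := fP j.
  have e : xchoose (ex i) = xchoose (ex j) by apply: (congr1 val fij).
  rewrite e in hi; have := roiB hi hj; congr (O _); ring.
have : vge w 1 (u ^+ i * (1 - u ^+ (j - i).-1 * u)).
  rewrite -exprSr prednK ?subn_gt0 // mulrBr mulr1 -exprD subnKC ?(ltnW ij) //.
  rewrite -[X in vge w 1 X](divfK p0) -[1]add0r.
  apply: vgeM; [exact: integral_vge0 | by right; rewrite wp].
have Oa : O (u ^+ (j - i).-1) by apply: roiX.
move=> /nvge1M[|||].
- exact/integral_vge0/roiX.
- by apply: integral_vge0; apply: roiB; [exact: roi1 | apply: roiM].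
- by move=> /vge1X; case/(_ (integral_vge0 w Ou))/hu.
by exists (u ^+ (j - i).-1).
Qed.

(** The ring of integers surjects onto the residue field at w: the denominator
    u of y prime to w has an inverse modulo the prime at w. *)
Lemma residue_lift w y : vge w 0 y -> exists2 a, O a & vge w 1 (y - a).
Proof.
move=> hy; have [u [Ou hu Ouy]] := unit_denominator hy.
have [a Oa ha] := prime_maximal Ou hu; exists (a * (u * y)); first exact: roiM.
have -> : y - a * (u * y) = y * (1 - a * u) by ring.
exact: vgeM0.
Qed.

Lemma place_ext v w : ordv v =1 ordv w -> v = w.
Proof.
case: v w => [f f0 fM fD fs] [g g0 gM gD gs] /= /funext fg.
by case: _ / fg in g0 gM gD gs *; congr Place; apply: Prop_irrelevance.
Qed.

(** A place is determined by its valuation ring, and the latter, being a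
    localization, by its prime ideal. *)
Lemma prime_of_place_sub v w :
  (forall x, O x -> vge v 1 x -> vge w 1 x) -> v = w.
Proof.
move=> vw.
have wv x : O x -> vge w 1 x -> vge v 1 x.
  move=> Ox hx; apply: contrapT => nx; have [a Oa ha] := prime_maximal Ox nx.
  have := vw _ (roiB (@roi1 K) (roiM Oa Ox)) ha => h; apply: (@nvge1 w).
  rewrite -[1 : K](subrK (a * x)); apply: vgeD => //.
  by apply: vgeM0 => //; apply: integral_vge0.
have ring x : vge w 0 x -> vge v 0 x.
  move=> /unit_denominator[u [Ou hu Oux]].
  have [u0 vu] : u != 0 /\ v u = 0.
    by apply: unit_of_vge; [exact: integral_vge0 | move=> /vw; case/(_ Ou)/hu].
  have [->|x0] := eqVneq x 0; first exact: vge0.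
  right; have := vge_neq0 (mulf_neq0 u0 x0) (integral_vge0 v Oux).
  by rewrite ordvM // vu add0r.
have [p [Op p0 wp]] := uniformizer w.
have vunit x : x != 0 -> w x = 0 -> v x = 0.
  move=> x0 wx; have h : vge w 0 x by right; rewrite wx.
  have h' : vge w 0 x^-1 by right; rewrite ordvV // wx.
  have := vge_neq0 x0 (ring _ h); have := vge_neq0 (invr_neq0 x0) (ring _ h').
  rewrite ordvV //; lia.
have pV0 : p^-1 != 0 by rewrite invr_eq0.
have vE x : x != 0 -> v x = w x * v p.
  move=> x0; case E : (w x) => [n|n].
    have z0 : x * p^-1 ^+ n != 0 by rewrite mulf_neq0 ?expf_neq0.
    have wz : w (x * p^-1 ^+ n) = 0.
      rewrite ordvM ?expf_neq0 // ordvX // ordvV // wp E; lia.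
    have := vunit _ z0 wz; rewrite ordvM ?expf_neq0 // ordvX // ordvV //; lia.
  rewrite NegzE in E *.
  have z0 : x * p ^+ n.+1 != 0 by rewrite mulf_neq0 ?expf_neq0.
  have wz : w (x * p ^+ n.+1) = 0.
    rewrite ordvM ?expf_neq0 // ordvX // wp E; lia.
  have := vunit _ z0 wz; rewrite ordvM ?expf_neq0 // ordvX //; lia.
have vp : v p = 1.
  have p1 : vge w 1 p by right; rewrite wp.
  have := vge_neq0 p0 (wv _ Op p1); have [y y0 vy] := ordv_surj v 1.
  move: (vE _ y0); rewrite vy => e h.
  by have [?|?] : w y <= 0 \/ 1 <= w y by [lia]; nia.
apply: place_ext => x; have [->|x0] := eqVneq x 0; first by rewrite !ordv0.
by rewrite vE // vp mulr1.
Qed.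

Lemma separating_integer v w : v != w -> exists x, [/\ O x, vge v 1 x & ~ vge w 1 x].
Proof.
move=> /eqP vw; apply: contrapT => h; apply: vw; apply: prime_of_place_sub.
by move=> x Ox hx; apply: contrapT => nx; apply: h; exists x.
Qed.

(** Since the residue ring modulo a uniformizer p is finite, the quotients of
    the elements of the prime at w by p have a common denominator u prime to w;
    then u / p generates the inverse of the prime locally at w. *)
Lemma prime_inverse w : exists y, [/\ y != 0, w y = -1 &
  forall x, O x -> vge w 1 x -> O (y * x)].
Proof.
have [p [Op p0 wp]] := uniformizer w.
have [L [OL hL]] := covers_neq0 Op p0.
have [u [Ou hu huL]] : exists u, [/\ O u, ~ vge w 1 u &
    forall l, l \in L -> vge w 1 l -> O (u * (l / p))].
  elim: L OL {hL} => [|l L IH] OL; first by exists 1; split; [exact: roi1 | exact: nvge1|].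
  have [|u [Ou hu huL]] := IH; first by move=> x xL; apply: OL; rewrite inE xL orbT.
  have [hl|nl] := pselect (vge w 1 l); last first.
    exists u; split=> // x; rewrite inE => /orP[/eqP->|]; first by move=> /nl.
    exact: huL.
  have h0 : vge w 0 (l / p).
    rewrite -[0]/(1 + (-1) : int); apply: vgeM => //; right.
    by rewrite ordvV // wp.
  have [t [Ot ht Otl]] := unit_denominator h0.
  exists (u * t); split; first exact: roiM.
    by move=> /nvge1M[|||//]; [exact: integral_vge0 | exact: integral_vge0|].
  move=> x; rewrite inE => /orP[/eqP-> _|xL hx].
    by rewrite -mulrA; apply: roiM.
  by rewrite [u * t]mulrC -mulrA; apply: roiM => //; apply: huL.
have [u0 wu] := unit_of_vge (integral_vge0 w Ou) hu.
exists (u / p); split.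
- by rewrite mulf_neq0 ?invr_neq0.
- by rewrite ordvM ?invr_neq0 // ordvV // wu wp.
move=> x Ox hx; have [l lL Ol] := hL _ Ox.
have pK : x = l + p * ((x - l) / p) by field.
have hl : vge w 1 l.
  have -> : l = x - p * ((x - l) / p) by field.
  apply: vgeB => //; rewrite -[1]addr0; apply: vgeM; last exact: integral_vge0.
  by right; rewrite wp.
have := roiD (huL _ lL hl) (roiM Ou Ol); congr (O _); field; exact: p0.
Qed.

Lemma prime_inverse_vge v w y : v != w ->
  (forall x, O x -> vge w 1 x -> O (y * x)) -> vge v 0 y.
Proof.
rewrite eq_sym => wv h; have [x [Ox wx vx]] := separating_integer wv.
have [x0 vx0] := unit_of_vge (integral_vge0 v Ox) vx.
have [->|y0] := eqVneq y 0; first exact: vge0.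
right; have := vge_neq0 (mulf_neq0 y0 x0) (integral_vge0 v (h _ Ox wx)).
by rewrite ordvM // vx0 addr0.
Qed.

(** The prime of a place in this set contains x, so it is determined by the
    representatives of the finite residue ring modulo x that it contains. *)
Lemma finite_places_integral (x : K) : O x -> x != 0 ->
  finite_set [set v | vge v 1 x].
Proof.
move=> Ox x0; have [L [OL hL]] := covers_neq0 Ox x0.
pose f v := [ffun i : 'I_(size L) => `[< vge v 1 L`_i >]].
have finj : {in [set v | vge v 1 x] &, injective f}.
  move=> v w /set_mem vx /set_mem wx fvw.
  apply: prime_of_place_sub => y Oy vy; have [l lL Ol] := hL _ Oy.
  have cong v' : vge v' 1 x -> vge v' 1 (y - l).
    move=> hx; rewrite -[y - l](divfK x0); apply: vgeM0 => //.
    exact: integral_vge0.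
  have vl : vge v 1 l by rewrite -[l](subKr y); apply: vgeB => //; apply: cong.
  rewrite -[y](subrK l); apply: vgeD; first exact: cong.
  have il : (index l L < size L)%N by rewrite index_mem.
  move: (congr1 (fun g : {ffun _} => g (Ordinal il)) fvw); rewrite !ffunE /= nth_index //.
  by move=> e; apply/asboolP; rewrite -e; apply/asboolP.
by rewrite -(eq_finite_set (inj_card_eq finj)); apply: finite_finset.
Qed.

Lemma finite_places (x : K) : x != 0 -> finite_set [set v : place K | v x != 0].
Proof.
move=> x0; have [N N0 ON] := integer_denominator x.
have NK : N%:~R != 0 :> K by rewrite intrK_eq0.
have h1 := finite_places_integral ON (mulf_neq0 NK x0).
have h2 := finite_places_integral (roi_int K N) NK.
have /sub_finite_set : [set v : place K | v x != 0] `<=`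
    [set v | vge v 1 (N%:~R * x)] `|` [set v | vge v 1 N%:~R].
  move=> v /= vx; have [?|nN] := pselect (vge v 1 N%:~R); [by right|left].
  have [_ vN] := unit_of_vge (vge_int v N) nN.
  have := vge_neq0 (mulf_neq0 NK x0) (integral_vge0 v ON).
  by rewrite ordvM // vN add0r => hx; right; rewrite ordvM // vN add0r; lia.
by apply; rewrite finite_setU; split.
Qed.

End Places.

(** * Ideals given by exponents: norm and radical *)

Section Ideals.
Variable K : fieldExtType rat.
Local Notation O := (@ring_of_integers K).
Implicit Types (v w : place K) (e : place K -> nat) (I : set K).

(** Describing the ideal with exponents e by valuations makes its
    products and residue rings accessible without factoring ideals. *)
Definition exponent_ideal e : set K :=
  [set x | O x /\ forall v, vge v (e v) x].
Local Notation J := exponent_ideal.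

Definition single w (n : nat) : place K -> nat := fun v => if v == w then n else 0%N.

Lemma exponent_ideal_ideal e : is_ideal (J e).
Proof.
split.
- by move=> x [].
- by split=> [|v]; [exact: roi0 | exact: vge0].
- by move=> x y [Ox hx] [Oy hy]; split=> [|v]; [exact: roiD | exact: vgeD].
- move=> a x Oa [Ox hx]; split=> [|v]; first exact: roiM.
  by apply: vgeM0 => //; apply: integral_vge0.
Qed.

Lemma exponent_idealB e x y : J e x -> J e y -> J e (x - y).
Proof. by move=> [Ox hx] [Oy hy]; split=> [|v]; [exact: roiB | exact: vgeB]. Qed.

Lemma exponent_ideal0 : J (fun=> 0%N) = O.
Proof.
apply/seteqP; split=> [x []//|x Ox]; split=> // v; exact: integral_vge0.
Qed.

Lemma exponent_ideal1 w : J (single w 1) = prime_of_place w.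
Proof.
apply/seteqP; split=> x [Ox hx]; split=> //.
  by have := hx w; rewrite /single eqxx.
move=> v; rewrite /single; case: eqP => [->|_] //; exact: integral_vge0.
Qed.

Lemma ideal_mul_sub (I1 I2 I3 : set K) : is_ideal I3 ->
  (forall x y, I1 x -> I2 y -> I3 (x * y)) -> ideal_mul I1 I2 `<=` I3.
Proof.
move=> [_ I0 ID _] h x [s hs ->]; rewrite big_seq.
elim/big_ind: _ => // t /hs[]; exact: h.
Qed.

Lemma ideal_mulP (I1 I2 : set K) x y : I1 x -> I2 y -> ideal_mul I1 I2 (x * y).
Proof.
move=> hx hy; exists [:: (x, y)]; last by rewrite big_seq1.
by move=> t; rewrite inE => /eqP ->.
Qed.

Lemma ideal_mulD (I1 I2 : set K) x y :
  ideal_mul I1 I2 x -> ideal_mul I1 I2 y -> ideal_mul I1 I2 (x + y).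
Proof.
move=> [s hs ->] [t ht ->]; exists (s ++ t); last by rewrite big_cat.
by move=> z; rewrite mem_cat => /orP[/hs|/ht].
Qed.

Lemma ideal_mul0 (I1 I2 : set K) : ideal_mul I1 I2 0.
Proof. by exists [::]; rewrite ?big_nil. Qed.

(** Multiplication by an element of negative valuation at w alone shows that
    the prime at w divides every element vanishing at w. *)
Lemma mul_prime w e :
  ideal_mul (prime_of_place w) (J e) = J (fun v => single w 1 v + e v)%N.
Proof.
apply/seteqP; split.
  apply: ideal_mul_sub (exponent_ideal_ideal _) _ => x y [Ox hx] [Oy hy].
  split=> [|v]; first exact: roiM.
  rewrite PoszD; apply: vgeM => //; rewrite /single; case: eqP => [->//|_].
  exact: integral_vge0.
move=> x [Ox hx]; have [y [y0 wy hy]] := prime_inverse w.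
have [p [Op p0 wp]] := uniformizer w.
have p1 : vge w 1 p by right; rewrite wp.
have [a Oa ha] : exists2 a, O a & vge w 1 (1 - a * (y * p)).
  apply: prime_maximal; first exact: hy.
  case=> [/eqP|]; first by rewrite mulf_eq0 (negPf y0) (negPf p0).
  by rewrite ordvM // wy wp.
have hxe v : vge v (e v) x by apply: vgeW (hx v); rewrite lez_nat leq_addl.
have -> : x = p * (x * y * a) + (1 - a * (y * p)) * x by ring.
apply: ideal_mulD; apply: ideal_mulP; split=> //.
- apply: roiM => //; rewrite mulrC; apply: hy => //.
  by apply: vgeW (hx w); rewrite /single eqxx lez_nat leq_addr.
- move=> v; rewrite mulrC; apply: vgeM0; first exact: integral_vge0.
  case: (eqVneq v w) => [->|vw].
    have -> : (e w)%:Z = (single w 1 w + e w)%N%:Z + (-1).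
      by rewrite /single eqxx PoszD; lia.
    by apply: vgeM => //; right; rewrite wy.
  by rewrite mulrC; apply: vgeM0 => //; apply: prime_inverse_vge vw hy.
- by apply: roiB; [exact: roi1 | apply: roiM => //; apply: hy].
Qed.

Lemma ideal_exp_prime w n : ideal_exp (prime_of_place w) n = J (single w n).
Proof.
elim: n => [|n IH].
  rewrite /ideal_exp /= -exponent_ideal0; congr J; apply/funext => v.
  by rewrite /single; case: eqP.
rewrite /ideal_exp iterS -/(ideal_exp _ n) IH mul_prime; congr J.
by apply/funext => v; rewrite /single; case: eqP.
Qed.

Lemma mul_prime_power w n e :
  ideal_mul (J (single w n)) (J e) = J (fun v => single w n v + e v)%N.
Proof.
apply/seteqP; split.
  apply: ideal_mul_sub (exponent_ideal_ideal _) _ => x y [Ox hx] [Oy hy].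
  by split=> [|v]; [exact: roiM | rewrite PoszD; apply: vgeM].
elim: n => [|n IH] x.
  move=> [Ox hx]; rewrite -[x]mul1r; apply: ideal_mulP.
    split=> [|v]; first exact: roi1.
    by rewrite /single; case: eqP => _; apply: vge1.
  by split=> // v; have := hx v; rewrite /single; case: eqP.
have -> : J (fun v => single w n.+1 v + e v)%N =
          J (fun v => single w 1 v + (single w n v + e v))%N.
  by congr J; apply/funext => v; rewrite /single; case: eqP.
rewrite -mul_prime => -[s hs ->]; rewrite big_seq.
elim/big_ind: _ => [|y z|t /hs[Pt1 /IH [s' hs' ->]]].
- exact: ideal_mul0.
- exact: ideal_mulD.
rewrite mulr_sumr big_seq; elim/big_ind: _ => [|y z|u /hs'[[Ou1 hu1] hu2]].
- exact: ideal_mul0.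
- exact: ideal_mulD.
rewrite mulrA; apply: ideal_mulP => //.
move: Pt1 => [Ot1 ht1]; split=> [|v]; first exact: roiM.
have -> : (single w n.+1 v)%:Z = (single w 1 v)%:Z + (single w n v)%:Z.
  by rewrite -PoszD /single; case: eqP.
apply: vgeM => //; rewrite /single; case: eqP => [->//|_].
exact: integral_vge0.
Qed.

(** Outside s the exponents are cut off, since the product only sees s. *)
Lemma big_exponents (s : seq (place K)) e : uniq s ->
  \big[@ideal_mul K/O]_(v <- s) ideal_exp (prime_of_place v) (e v) =
  J (fun v => if v \in s then e v else 0%N).
Proof.
elim: s => [|w s IH] /=; first by rewrite big_nil -exponent_ideal0.
move=> /andP[ws us]; rewrite big_cons IH // ideal_exp_prime mul_prime_power.
congr J; apply/funext => v; rewrite /single inE.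
by case: (eqVneq v w) => [->|_] //=; rewrite (negPf ws) addn0.
Qed.

Lemma exponent_ideal_eqO w n : (J (single w n) = O) -> n = 0%N.
Proof.
case: n => // n h; have : J (single w n.+1) 1 by rewrite h; exact: roi1.
case=> _ /(_ w); rewrite /single eqxx => /(vgeW (_ : 1 <= _)) h'.
by case: (@nvge1 _ w); apply: h'.
Qed.

Lemma ideal_of_exponentsE (S : set (place K)) e : (forall v, S v) ->
  finite_set [set v | e v != 0%N] -> ideal_of_exponents S e = J e.
Proof.
move=> ST fin; rewrite /ideal_of_exponents.
have supp : S `&` (fun v => ideal_exp (prime_of_place v) (e v)) @^-1` [set~ O]
    = [set v | e v != 0%N].
  apply/seteqP; split=> v /=.
    case=> _; rewrite ideal_exp_prime; apply: contra_notN => /eqP->.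
    rewrite -exponent_ideal0; congr J.
    by apply/funext => w; rewrite /single; case: eqP.
  by move=> ev; split=> //; rewrite ideal_exp_prime => /exponent_ideal_eqO /eqP; apply/negP.
have mem := @in_finite_support _ _ O S (fun v => ideal_exp (prime_of_place v) (e v)).
rewrite supp in mem; rewrite big_exponents; last exact: finite_support_uniq.
congr J; apply/funext => v; rewrite (mem fin).
case: ifP => // /negP h; apply/esym/eqP; apply: contrapT => /negP ev.
by apply: h; apply/mem_set.
Qed.

(** ** Norms *)

Definition residue_system (T : finType) I (f : T -> K) :=
  (forall i, O (f i)) /\ forall x, O x -> exists! i, I (x - f i).

(** This makes the norm, which is chosen among the sizes of residue systems,
    well defined. *)
Lemma residue_system_card (T U : finType) e (f : T -> K) (g : U -> K) :
  residue_system (J e) f -> residue_system (J e) g -> (#|T| <= #|U|)%N.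
Proof.
move=> [Of hf] [Og hg].
have ex i : exists j, J e (f i - g j) by have [j []] := hg _ (Of i); exists j.
have {ex} [h hh] := choice ex.
apply: (@leq_card _ _ h) => i i' hii; have [k [_ ku]] := hf _ (Of i).
rewrite -(ku i) ?(ku i') //.
  have -> : f i - f i' = (f i - g (h i)) - (f i' - g (h i)) by ring.
  by apply: exponent_idealB => //; rewrite hii.
by rewrite subrr; case: (exponent_ideal_ideal e).
Qed.

Lemma ideal_normE (T : finType) e (f : T -> K) :
  residue_system (J e) f -> ideal_norm (J e) = #|T|.
Proof.
move=> hf; rewrite /ideal_norm.
have ord : residue_system (J e) (fun i : 'I_#|T| => f (enum_val i)).
  case: hf => Of hf; split=> [i //|x /hf[t [ht tu]]]; exists (enum_rank t).
  by split; [rewrite enum_rankK | move=> i /tu ->; rewrite enum_valK].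
case: xgetP => [n _ [g hg]|/(_ #|T|) []]; last by eexists; exact: ord.
have := residue_system_card hf hg; have := residue_system_card hg hf.
by rewrite card_ord => h1 h2; apply/eqP; rewrite eqn_leq h1 h2.
Qed.

(** A finite list of representatives modulo a uniformizer is thinned out until
    its members are pairwise incongruent modulo the prime. *)
Lemma residue_system_prime w :
  exists2 n, (0 < n)%N & exists f : 'I_n -> K, residue_system (prime_of_place w) f.
Proof.
rewrite -exponent_ideal1; set I := J _.
have [p [Op p0 wp]] := uniformizer w; have [L [OL hL]] := covers_neq0 Op p0.
have IB : forall x y, I x -> I y -> I (x - y) by exact: exponent_idealB.
have I0 : I 0 by case: (exponent_ideal_ideal (single w 1)).
have IN x : I x -> I (- x) by rewrite -sub0r; apply: IB.
have ID x y : I x -> I y -> I (x + y) by move=> hx /IN hy; rewrite -[y]opprK; apply: IB.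
have Ip x : O x -> I (p * x).
  move=> Ox; rewrite /I exponent_ideal1; split; first exact: roiM.
  change (vge w (1 + 0) (p * x)); apply: vgeM; [by right; rewrite wp | exact: integral_vge0].
have [s [Os us cs]] : exists s : seq K, [/\ forall l, l \in s -> O l,
    forall i j, (i < size s)%N -> (j < size s)%N -> I (s`_i - s`_j) -> i = j &
    forall l, l \in L -> exists2 t, t \in s & I (l - t)].
  elim: L OL {hL} => [|l L IH] OL; first by exists [::].
  have [|s [Os us cs]] := IH; first by move=> x xL; apply: OL; rewrite inE xL orbT.
  have [[t ts lt]|nl] := pselect (exists2 t, t \in s & I (l - t)).
    exists s; split=> // x; rewrite inE => /orP[/eqP->|/cs //]; by exists t.
  exists (l :: s); split.
  - by move=> x; rewrite inE => /orP[/eqP->|/Os //]; apply: OL; rewrite mem_head.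
  - move=> [|i] [|j] //= hi hj h.
    + by case: nl; exists s`_j => //; apply: mem_nth.
    + by case: nl; exists s`_i; [apply: mem_nth | rewrite -opprB; apply: IN].
    + by congr _.+1; apply: us.
  - move=> x; rewrite inE => /orP[/eqP->|/cs[t ts xt]].
      by exists l; rewrite ?mem_head ?subrr.
    by exists t; rewrite ?inE ?ts ?orbT.
have cov x : O x -> exists2 t, t \in s & I (x - t).
  move=> Ox; have [l lL Ol] := hL _ Ox; have [t ts lt] := cs _ lL; exists t => //.
  have -> : x - t = p * ((x - l) / p) + (l - t) by field.
  by apply: ID => //; apply: Ip.
exists (size s).
  by have [t ts _] := cov _ (@roi0 K); case: s ts {Os us cs cov}.
exists (fun i => s`_i); split=> [i|x Ox]; first by apply: Os; apply: mem_nth.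
have [t ts xt] := cov _ Ox; have it : (index t s < size s)%N by rewrite index_mem.
exists (Ordinal it); split=> [|i xi]; first by rewrite /= nth_index.
apply/val_inj; apply: us => //=; rewrite nth_index //.
have -> : t - s`_i = (x - s`_i) - (x - t) by ring.
exact: IB.
Qed.

(** The factor for an occurrence of u in l is a uniformizer if u = w, and an
    integer vanishing at u but not at w otherwise. *)
Lemma exact_exponent w (l : seq (place K)) :
  exists t, [/\ J (fun v => count_mem v l) t, t != 0 & w t = (count_mem w l)%:Z].
Proof.
elim: l => [|u l [t [[Ot ht] t0 wt]]].
  exists 1; split; rewrite ?oner_eq0 ?ordv1 //.
  by split=> [|v]; [exact: roi1 | exact: vge1].
have [y [Oy y0 uy wy]] : exists y, [/\ O y, y != 0, vge u 1 y & w y = (u == w)%:Z].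
  case: (eqVneq u w) => [->|uw].
    by have [p [Op p0 wp]] := uniformizer w; exists p; split=> //; right; rewrite wp.
  have [y [Oy uy ny]] := separating_integer uw.
  by have [y0 wy] := unit_of_vge (integral_vge0 w Oy) ny; exists y.
exists (y * t); split; first split.
- exact: roiM.
- move=> v /=; rewrite PoszD; apply: vgeM => //.
  by case: eqP => [<-//|_]; apply: integral_vge0.
- exact: mulf_neq0.
- by rewrite ordvM // wy wt /= PoszD.
Qed.

(** If t has exactly the exponent of the ideal I at w, then multiplication by t
    identifies the residue field at w with the quotient of I by P_w I. *)
Lemma residue_system_mul w (l : seq (place K)) (T U : finType)
    (f : T -> K) (g : U -> K) :
  residue_system (J (fun v => count_mem v l)) f ->
  residue_system (prime_of_place w) g ->
  exists h : T * U -> K, residue_system (J (fun v => count_mem v (w :: l))) h.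
Proof.
move=> [Of hf] [Og hg]; have [t [Jt t0 wt]] := exact_exponent w l.
have [Ot ht] := Jt.
set e := (fun v => count_mem v l) in hf Jt ht.
have eE : (fun v => count_mem v (w :: l)) = (fun v => single w 1 v + e v)%N.
  by apply/funext => v; rewrite /= /single eq_sym; case: eqP.
have sub x : J (fun v => single w 1 v + e v)%N x -> J e x.
  by move=> [Ox hx]; split=> // v; apply: vgeW (hx v); rewrite lez_nat leq_addl.
exists (fun ij => f ij.1 + t * g ij.2); split=> [[i j]|x Ox] /=.
  by apply: roiD => //; apply: roiM.
rewrite eE; have [i [xi iu]] := hf _ Ox.
have [Oxi hxi] := xi.
have wq : vge w 0 ((x - f i) / t).
  have := hxi w; have [->|d0] := eqVneq (x - f i) 0; first by rewrite mul0r; left.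
  by move=> /(vge_neq0 d0) h; right; rewrite ordvM ?invr_neq0 // ordvV // wt subr_ge0.
have [a Oa ha] := residue_lift wq.
have [j [aj ju]] := hg _ Oa.
have [Oaj haj] := aj.
have tw : vge w (e w) t by right; rewrite wt.
exists (i, j); split.
  have E : x - (f i + t * g j) = (x - f i) - t * g j by ring.
  split=> /= [|v]; first by rewrite E; apply: roiB => //; apply: roiM.
  rewrite /= E PoszD /single; case: eqP => [->|_]; last first.
    rewrite add0r; apply: vgeB => //; rewrite mulrC; apply: vgeM0 => //.
    exact: integral_vge0.
  have -> : x - f i - t * g j = ((x - f i) / t - a + (a - g j)) * t by field.
  by apply: vgeM => //; apply: vgeD.
move=> [i' j'] /= h.
have ii' : i = i'.
  apply: iu; have -> : x - f i' = x - (f i' + t * g j') + t * g j' by ring.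
  have [_ _ JD JM] := exponent_ideal_ideal e.
  apply: JD; first exact: sub.
  by rewrite mulrC; apply: JM.
subst i'; congr (_, _); apply: ju; split; first exact: roiB.
change (vge w 1 (a - g j')).
have {h} [_ /(_ w)] := h; rewrite /single eqxx PoszD => h.
have -> : a - g j' = (x - (f i + t * g j')) / t - ((x - f i) / t - a) by field.
apply: vgeB ha.
apply: (@vgeW _ _ ((1 + (e w)%:Z) + - (e w)%:Z)); first by lia.
by apply: vgeM => //; right; rewrite ordvV // wt.
Qed.

(** Each prime factor at v multiplies the norm by q v, the norm of that prime;
    norms are thus compared by comparing exponents. *)
Lemma ideal_norm_exponents : exists2 q : place K -> nat, (forall v, (0 < q v)%N) &
  forall e s, uniq s -> (forall v, e v != 0%N -> v \in s) ->
    ideal_norm (J e) = (\prod_(v <- s) q v ^ e v)%N.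
Proof.
have ex v : exists n, (0 < n)%N /\
    exists f : 'I_n -> K, residue_system (prime_of_place v) f.
  by have [n n0 hn] := residue_system_prime v; exists n.
have [q hq] := choice ex.
exists q => [v|e s us hs]; first by case: (hq v).
have key (l : seq (place K)) : exists (T : finType) (f : T -> K),
    residue_system (J (fun v => count_mem v l)) f /\ #|T| = (\prod_(v <- l) q v)%N.
  elim: l => [|w l [T [f [hf cT]]]].
    exists unit, (fun=> 0); rewrite big_nil card_unit exponent_ideal0; split=> //.
    split=> [_|x Ox]; first exact: roi0.
    by exists tt; rewrite subr0; split=> // -[].
  have [_ [g hg]] := hq w; have [h hh] := residue_system_mul hf hg.
  by exists (T * 'I_(q w))%type, h; rewrite card_prod card_ord big_cons cT mulnC.
have [T [f [hf cT]]] := key (flatten [seq nseq (e v) v | v <- s]).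
have eE : (fun v => count_mem v (flatten [seq nseq (e v) v | v <- s])) = e.
  apply/funext => v; rewrite count_flatten -map_comp sumnE big_map.
  under eq_bigr do rewrite /= count_nseq.
  have [vs|vs] := boolP (v \in s).
    rewrite (bigD1_seq v) //= eqxx mul1n big1 ?addn0 // => w /negPf wv.
    by rewrite wv.
  have /eqP -> : e v == 0%N by apply: contraNT vs => /hs.
  rewrite big1_seq // => w /andP[_ ws] /=; case: eqP => [wv|_] //.
  by rewrite -wv ws in vs.
rewrite eE in hf; rewrite (ideal_normE hf) cT big_flatten big_map.
by apply: eq_bigr => v _; rewrite big_nseq iter_muln muln1.
Qed.

(** ** Radicals *)

Lemma prime_of_place_prime w : is_prime_ideal (prime_of_place w).
Proof.
split; first by rewrite -exponent_ideal1; apply: exponent_ideal_ideal.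
  by case=> _ /nvge1.
move=> x y Ox Oy [_ /nvge1M[||h|h]]; rewrite -/(vge _ 0 _).
- exact: integral_vge0.
- exact: integral_vge0.
- by left.
- by right.
Qed.

(** Otherwise P would contain the product of powers of elements t v of the
    primes of v lying outside P.  Once P contains the prime of v, it equals it
    by maximality. *)
Lemma prime_dvd_exponents (P : set K) e s : is_prime_ideal P -> uniq s ->
  (forall v, e v != 0%N -> v \in s) -> J e `<=` P ->
  exists2 v, e v != 0%N & P = prime_of_place v.
Proof.
move=> [[PO P0 PD PM] P1 PP] us hs sub.
have [v ev Pv] : exists2 v, e v != 0%N & prime_of_place v `<=` P.
  apply: contrapT => h.
  have ex v : exists t, O t /\ (e v != 0%N -> vge v 1 t /\ ~ P t).
    have [ev|ev] := boolP (e v != 0%N); last by exists 1; split=> //; exact: roi1.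
    apply: contrapT => h'; apply: h; exists v => // x [Ox vx].
    by apply: contrapT => Px; apply: h'; exists x.
  have [t ht] := choice ex.
  pose m (l : seq (place K)) := \prod_(v <- l) t v ^+ e v.
  have Om l : O (m l).
    rewrite /m; elim/big_ind: _ => [|x y|v _]; [exact: roi1 | exact: roiM | apply: roiX].
    by case: (ht v).
  have nPX x n : O x -> ~ P x -> ~ P (x ^+ n).
    move=> Ox Px; elim: n => [|n IHn]; first by rewrite expr0.
    by rewrite exprS => /(PP _ _ Ox (roiX n Ox))[].
  have nP l : ~ P (m l).
    elim: l => [|v l IH]; rewrite /m ?big_nil // big_cons.
    have [Otv htv] := ht v.
    move=> /(PP _ _ (roiX _ Otv) (Om l)) [|//].
    have [->|/htv[_ ntv]] := eqVneq (e v) 0%N; first by rewrite expr0.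
    exact: nPX.
  apply: (nP s); apply: sub; split=> // v.
  have [->|ev] := eqVneq (e v) 0%N; first exact: integral_vge0.
  rewrite /m (bigD1_seq v) ?hs //= mulrC; apply: vgeM0.
    apply: integral_vge0; elim/big_ind: _ => [|x y|w _]; [exact: roi1 | exact: roiM | apply: roiX].
    by case: (ht w).
  have [_ /(_ ev) [tv _]] := ht v.
  elim: (e v) => [|n IHn]; first by rewrite expr0; apply: vge1.
  by rewrite exprS -add1n PoszD; apply: vgeM.
exists v => //; apply/seteqP; split=> // x Px; split; first exact: PO.
apply: contrapT => nx; have [a Oa ha] := prime_maximal (PO _ Px) nx.
apply: P1; rewrite -[1](subrK (a * x)); apply: PD; last exact: PM.
apply: Pv; split=> //; apply: roiB; [exact: roi1 | apply: roiM => //; exact: PO].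
Qed.

Lemma prime_of_place_inj : injective (@prime_of_place K).
Proof.
move=> v w h; apply: prime_of_place_sub => x Ox vx.
by have : prime_of_place w x by [rewrite -h; split]; case.
Qed.

(** The prime ideals dividing the ideal are the primes of the places in the
    support of e, so the radical is again a product over places. *)
Lemma radicalE e : finite_set [set v | e v != 0%N] ->
  radical (J e) = J (fun v => (e v != 0)%N : nat).
Proof.
move=> fin; have /finite_seqP[s se] := fin.
have hs v : e v != 0%N -> v \in undup s.
  by move=> ev; rewrite mem_undup; have : [set` s] v by rewrite -se.
rewrite /radical.
set S := [set P | _].
have SE : S = @prime_of_place K @` [set v | e v != 0%N].
  apply/seteqP; split=> P.
    move=> [Pp [C CI JC]].
    have [|v ev ->] := @prime_dvd_exponents P e (undup s) Pp (undup_uniq s) hs.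
      rewrite JC; apply: ideal_mul_sub; first by case: Pp.
      move=> x y Px Cy; case: Pp => -[_ _ _ PM] _ _; rewrite mulrC; apply: PM => //.
      by case: CI => CO _ _ _; apply: CO.
    by exists v.
  move=> [v /= ev <-]; split; first exact: prime_of_place_prime.
  exists (J (fun w => e w - single v 1 w)%N); first exact: exponent_ideal_ideal.
  rewrite mul_prime; congr J; apply/funext => w; rewrite /single.
  by case: eqP => [->|_]; rewrite ?subnKC ?lt0n ?subn0.
have finS : finite_set S by rewrite SE; apply: finite_image.
have supp : S `&` (fun P : set K => P) @^-1` [set~ O] = S.
  apply/seteqP; split=> [P []//|P SP]; split=> // PO.
  by case: SP => -[_ P1 _] _; apply: P1; rewrite PO; exact: roi1.
have mem := @in_finite_support _ _ O S (fun P => P).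
rewrite supp in mem; move/(_ finS) in mem.
have uS := @finite_support_uniq _ _ O S (fun P => P).
set r := finite_support _ _ _ in mem uS *.
have [l lr] : exists l, r = map (@prime_of_place K) l.
  have : forall P, P \in r -> S P by move=> P; rewrite mem => /set_mem.
  elim: (r) => [|P r' IH] h; first by exists [::].
  have [|l ->] := IH; first by move=> Q Qr; apply: h; rewrite inE Qr orbT.
  have : S P by apply: h; rewrite mem_head.
  by rewrite SE => -[v _ <-]; exists (v :: l).
have ul : uniq l by move: uS; rewrite lr; apply: map_uniq.
rewrite lr big_map.
have -> : \big[@ideal_mul K/O]_(v <- l) prime_of_place v =
          \big[@ideal_mul K/O]_(v <- l) ideal_exp (prime_of_place v) 1.
  by apply: eq_bigr => v _; rewrite ideal_exp_prime exponent_ideal1.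
rewrite (big_exponents (fun=> 1%N)) //; congr J; apply/funext => v.
have -> : (v \in l) = (e v != 0%N); last by case: (e v != 0%N).
rewrite -(mem_map prime_of_place_inj) -lr mem; apply/idP/idP.
  by move=> /set_mem; rewrite SE => -[w ew /prime_of_place_inj <-].
by move=> ev; apply/mem_set; rewrite SE; exists v.
Qed.

End Ideals.

(** * Discriminants from roots *)

Section Discriminant.
Variable L : closedFieldType.

(** The recursive form makes invariance under permutations an induction. *)
Fixpoint root_disc (r : seq L) : L :=
  if r is x :: r' then \prod_(y <- r') (y - x) ^+ 2 * root_disc r' else 1.

Lemma root_discE (r : seq L) :
  root_disc r = \prod_(n < size r) \prod_(m < size r | (m < n)%N) (r`_m - r`_n) ^+ 2.
Proof.
rewrite (exchange_big_dep xpredT) //=.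
elim: r => [|x r IH] /=; first by rewrite big_ord0.
rewrite big_ord_recl IH; congr (_ * _).
  rewrite (big_nth 0) big_mkord [RHS]big_mkcond /= big_ord_recl mul1r.
  by apply: eq_bigr => i _; rewrite /= -sqrrN opprB.
apply: eq_bigr => i _; rewrite [RHS]big_mkcond big_ord_recl /= mul1r big_mkcond.
by apply: eq_bigr => j _.
Qed.

Lemma root_disc_perm (r s : seq L) : perm_eq r s -> root_disc r = root_disc s.
Proof.
have mid s1 s2 x : root_disc (s1 ++ x :: s2) = root_disc (x :: s1 ++ s2).
  elim: s1 => //= y s1 IH; rewrite IH /= !big_cat /= !big_cons !big_cat /=.
  ring.
elim: r s => [|x r IH] s; first by rewrite perm_sym => /perm_nilP ->.
move=> rs; have xs : x \in s by rewrite -(perm_mem rs) mem_head.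
case/splitPr: xs rs => s1 s2; rewrite mid perm_sym perm_catC cat_cons perm_cons.
rewrite perm_catC perm_sym => h /=; rewrite (IH _ h); congr (_ * _).
exact: perm_big.
Qed.

Lemma root_disc_eq0 (r : seq L) : (root_disc r == 0) = ~~ uniq r.
Proof.
elim: r => [|x r IH] /=; first by rewrite oner_eq0.
rewrite mulf_eq0 IH negb_and negbK; congr (_ || _).
apply/idP/idP.
  rewrite prodf_seq_eq0 => /hasP[y yr] /=.
  by rewrite expf_eq0 /= subr_eq0 => /eqP <-.
move=> xr; rewrite prodf_seq_eq0; apply/hasP; exists x => //=.
by rewrite subrr expr0n.
Qed.

Lemma prod_XsubC_perm (r s : seq L) :
  \prod_(z <- r) ('X - z%:P) = \prod_(z <- s) ('X - z%:P) -> perm_eq r s.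
Proof.
elim: r s => [|x r IH] s.
  rewrite big_nil => /(congr1 (fun p : {poly L} => size p)).
  by rewrite size_poly1 size_prod_XsubC; case: s.
move=> h; have xs : x \in s.
  by rewrite -root_prod_XsubC -h root_prod_XsubC mem_head.
case/splitPr: xs h => s1 s2; rewrite big_cons big_cat big_cons /= mulrCA.
move=> /(mulfI (negbT (polyXsubC_eq0 _))); rewrite -big_cat => /IH.
by rewrite -(perm_cons x) => /perm_trans; apply; rewrite perm_sym -cat1s perm_catCA.
Qed.

(** The roots selected by poly_disc may be replaced by those of any
    factorization. *)
Lemma poly_discE (c : L) (r : seq L) : c != 0 ->
  poly_disc (c *: \prod_(z <- r) ('X - z%:P)) =
  c ^+ (2 * size r - 2) * root_disc r.
Proof.
move=> c0; rewrite /poly_disc; case: closed_field_poly_normal => s /= hs.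
have lc : lead_coef (c *: \prod_(z <- r) ('X - z%:P)) = c.
  by rewrite lead_coefZ (monicP (monic_prod_XsubC _ _ _)) mulr1.
rewrite lc in hs *; move/(scalerI c0)/prod_XsubC_perm in hs.
by rewrite -root_discE (perm_size hs) (root_disc_perm hs).
Qed.

End Discriminant.

(** * The duplication map of an elliptic curve *)

Section Duplication.
Variable F : fieldType.
Implicit Types W : weierstrass F.

Definition wb2 W := wa1 W ^+ 2 + 4%:R * wa2 W.
Definition wb4 W := 2%:R * wa4 W + wa1 W * wa3 W.
Definition wb6 W := wa3 W ^+ 2 + 4%:R * wa6 W.
Definition wb8 W := wa1 W ^+ 2 * wa6 W + 4%:R * wa2 W * wa6 W
  - wa1 W * wa3 W * wa4 W + wa2 W * wa3 W ^+ 2 - wa4 W ^+ 2.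
Definition wc4 W := wb2 W ^+ 2 - 24%:R * wb4 W.

Lemma wdiscE W : wdisc W = - wb2 W ^+ 2 * wb8 W - 8%:R * wb4 W ^+ 3
  - 27%:R * wb6 W ^+ 2 + 9%:R * wb2 W * wb4 W * wb6 W.
Proof. by case: W. Qed.

Lemma wb8E W : 4%:R * wb8 W = wb2 W * wb6 W - wb4 W ^+ 2.
Proof. rewrite /wb8 /wb2 /wb6 /wb4; ring. Qed.

(** The x-coordinate of 2P is dup_num / dup_den at the x-coordinate of P. *)
Definition dup_num W : {poly F} :=
  Poly [:: - wb8 W; - 2%:R * wb6 W; - wb4 W; 0; 1].
Definition dup_den W : {poly F} := Poly [:: wb6 W; 2%:R * wb4 W; wb2 W; 4%:R].
Definition dup W : ratmap F := ratio_of (dup_num W) (dup_den W).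

Lemma dup_numE W : dup_num W = 'X^4 - (wb4 W)%:P * 'X^2
  - (2%:R * wb6 W)%:P * 'X - (wb8 W)%:P.
Proof. rewrite /dup_num /= !cons_poly_def; ring. Qed.

Lemma dup_denE W : dup_den W = 4%:R%:P * 'X^3 + (wb2 W)%:P * 'X^2
  + (2%:R * wb4 W)%:P * 'X + (wb6 W)%:P.
Proof. rewrite /dup_den /= !cons_poly_def; ring. Qed.

Lemma polyseq_dup_num W :
  dup_num W = [:: - wb8 W; - 2%:R * wb6 W; - wb4 W; 0; 1] :> seq F.
Proof. by rewrite (@PolyK _ 0) //= oner_neq0. Qed.

Lemma polyseq_dup_den W : (4%:R : F) != 0 ->
  dup_den W = [:: wb6 W; 2%:R * wb4 W; wb2 W; 4%:R] :> seq F.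
Proof. by move=> h; rewrite (@PolyK _ 0). Qed.

Lemma dup_standard W : (4%:R : F) != 0 ->
  standard_form 4 4%:R (dup_num W) (dup_den W).
Proof.
move=> h; rewrite /standard_form monicE !lead_coefE polyseq_dup_num.
by rewrite polyseq_dup_den.
Qed.

Lemma eq_dup W W' : (4%:R : F) != 0 ->
  wb2 W = wb2 W' -> wb4 W = wb4 W' -> wb6 W = wb6 W' ->
  [/\ dup_num W = dup_num W', dup_den W = dup_den W' & wdisc W = wdisc W'].
Proof.
move=> h4 h2' h4' h6'; have h8 : wb8 W = wb8 W'.
  by apply: (mulfI h4); rewrite !wb8E h2' h4' h6'.
by rewrite /dup_num /dup_den !wdiscE h2' h4' h6' h8.
Qed.

(** The curve whose duplication map is the conjugate of that of W by the
    substitution x -> al x + be; it is a quadratic twist of W by al, in the form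
    without a1 and a3. *)
Definition conj_curve (al be : F) W : weierstrass F := Weierstrass 0
  ((al * wb2 W - 12%:R * be) / 4%:R)
  0
  ((6%:R * be ^+ 2 - al * be * wb2 W + al ^+ 2 * wb4 W) / 2%:R)
  ((- 4%:R * be ^+ 3 + al * wb2 W * be ^+ 2 - 2%:R * al ^+ 2 * wb4 W * be
    + al ^+ 3 * wb6 W) / 4%:R).

Section Char.
Hypothesis two_neq0 : (2%:R : F) != 0.

Lemma four_neq0 : (4%:R : F) != 0.
Proof. by rewrite -[4%N]/(2 * 2)%N natrM mulf_neq0. Qed.

Section Conj.
Variables (al be : F) (W : weierstrass F).
Local Notation W' := (conj_curve al be W).

Lemma conj_b2 : wb2 W' = al * wb2 W - 12%:R * be.
Proof. by have := four_neq0; rewrite {1}/wb2 /= => h; field. Qed.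
Lemma conj_b4 : wb4 W' = 6%:R * be ^+ 2 - al * be * wb2 W + al ^+ 2 * wb4 W.
Proof. by rewrite {1}/wb4 /=; field. Qed.
Lemma conj_b6 : wb6 W' = - 4%:R * be ^+ 3 + al * wb2 W * be ^+ 2
  - 2%:R * al ^+ 2 * wb4 W * be + al ^+ 3 * wb6 W.
Proof. by have := four_neq0; rewrite {1}/wb6 /= => h; field. Qed.

Lemma wb8_solved W1 : wb8 W1 = (wb2 W1 * wb6 W1 - wb4 W1 ^+ 2) / 4%:R.
Proof. by rewrite -wb8E mulrC mulKf // four_neq0. Qed.

Lemma conj_c4 : wc4 W' = al ^+ 2 * wc4 W.
Proof. by rewrite /wc4 conj_b2 conj_b4; ring. Qed.

Lemma conj_disc : wdisc W' = al ^+ 6 * wdisc W.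
Proof.
rewrite !wdiscE !wb8_solved conj_b2 conj_b4 conj_b6.
by have h := four_neq0; field.
Qed.

Hypothesis al0 : al != 0.
Let s : {poly F} := al^-1 *: ('X - be%:P).

Lemma conj_var : 'X = al%:P * s + be%:P.
Proof. by rewrite /s mul_polyC scalerA divff // scale1r subrK. Qed.

Lemma dup_den_comp : dup_den W \Po s = 4%:R%:P * s ^+ 3 + (wb2 W)%:P * s ^+ 2
  + (2%:R * wb4 W)%:P * s + (wb6 W)%:P.
Proof.
by rewrite dup_denE !mul_polyC !comp_polyD !comp_polyZ comp_polyC !comp_Xn_poly comp_polyX.
Qed.

Lemma dup_num_comp : dup_num W \Po s = s ^+ 4 - (wb4 W)%:P * s ^+ 2
  - (2%:R * wb6 W)%:P * s - (wb8 W)%:P.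
Proof.
by rewrite dup_numE !mul_polyC !comp_polyB !comp_polyZ comp_polyC !comp_Xn_poly comp_polyX.
Qed.

Lemma conj_dup_den : dup_den W' = (al ^+ 3)%:P * (dup_den W \Po s).
Proof.
rewrite dup_den_comp dup_denE conj_b2 conj_b4 conj_b6 conj_var.
move: s (wb2 W) (wb4 W) (wb6 W) => z b2 b4 b6; ring.
Qed.

Lemma conj_dup_num : dup_num W' =
  (al ^+ 4)%:P * (dup_num W \Po s) + be%:P * dup_den W'.
Proof.
have h4 : (4%:R%:P : {poly F}) != 0 by rewrite polyC_eq0 four_neq0.
have h8 W1 : 4%:R%:P * (wb8 W1)%:P = (wb2 W1 * wb6 W1 - wb4 W1 ^+ 2)%:P.
  by rewrite -polyCM wb8E.
apply: (mulfI h4); have E := h8 W; have := h8 W'.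
rewrite dup_num_comp dup_denE dup_numE conj_b2 conj_b4 conj_b6 conj_var.
move: E; move: s (wb2 W) (wb4 W) (wb6 W) (wb8 W) (wb8 W').
move=> z b2 b4 b6 b8 b8' E E'.
move/eqP: E; rewrite -subr_eq0 => /eqP E; move/eqP: E'; rewrite -subr_eq0 => /eqP E'.
have e := congr2 (fun p q => p - (al ^+ 4)%:P * q) E' E.
rewrite mulr0 subr0 in e.
rewrite -[LHS]addr0 -[in LHS]e; ring.
Qed.

Lemma dup_den_neq0 W1 : dup_den W1 != 0.
Proof. by rewrite -size_poly_eq0 polyseq_dup_den ?four_neq0. Qed.

Lemma comp_neq0 (p : {poly F}) : p != 0 -> p \Po s != 0.
Proof.
move=> p0; rewrite -size_poly_eq0 size_comp_poly2 ?size_poly_eq0 //.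
by rewrite /s size_scale ?invr_eq0 // size_XsubC.
Qed.

Lemma frac_conj (E : fieldType) (a b n d : E) : a != 0 -> d != 0 ->
  a * (n / d) + b = (a ^+ 4 * n + b * (a ^+ 3 * d)) / (a ^+ 3 * d).
Proof. by move=> a1 d1; field; rewrite a1 d1. Qed.

(** The representation A / B of the duplication map need not be reduced, so
    that it is first replaced by the standard one. *)
Lemma conj_dup_ratio (A B : {poly F}) : B != 0 -> dup W = ratio_of A B ->
  FracField.tofrac al%:P * ratio_of (A \Po s) (B \Po s)
    + FracField.tofrac be%:P = dup W'.
Proof.
move=> B0 h.
have t0 (p : {poly F}) : p != 0 -> FracField.tofrac p != 0 by rewrite tofrac_eq0.
have cross : A * dup_den W = dup_num W * B.
  move/eqP: h; rewrite /dup /ratio_of eqr_div ?t0 ?dup_den_neq0 //.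
  by rewrite -!tofracM tofrac_eq => /eqP ->.
have Bs0 := t0 _ (comp_neq0 B0).
have Ds0 := t0 _ (comp_neq0 (dup_den_neq0 W)).
have a0 : FracField.tofrac al%:P != 0 by rewrite t0 // polyC_eq0.
have -> : ratio_of (A \Po s) (B \Po s) = ratio_of (dup_num W \Po s) (dup_den W \Po s).
  apply/eqP; rewrite /ratio_of (eqr_div _ _ Bs0 Ds0).
  rewrite -tofracM -tofracM tofrac_eq.
  have -> : (A \Po s) * (dup_den W \Po s) = (dup_num W \Po s) * (B \Po s).
    by rewrite -!(comp_polyM _ _ s) cross.
  exact: eqxx.
have den : FracField.tofrac (dup_den W') =
    FracField.tofrac al%:P ^+ 3 * FracField.tofrac (dup_den W \Po s).
  by rewrite conj_dup_den polyC_exp tofracM tofracXn.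
have num : FracField.tofrac (dup_num W') =
    FracField.tofrac al%:P ^+ 4 * FracField.tofrac (dup_num W \Po s) +
    FracField.tofrac be%:P * FracField.tofrac (dup_den W').
  rewrite conj_dup_num polyC_exp tofracD [X in X + _]tofracM tofracXn.
  by rewrite [X in _ + X = _]tofracM.
rewrite [LHS](frac_conj _ _ a0 Ds0); congr (_ / _); last exact: esym den.
rewrite -[in LHS]den; exact: esym num.
Qed.

Lemma conj_dup_iso : ratmap_iso (dup W) (dup W').
Proof.
exists al, be; split=> //; exists (dup_num W), (dup_den W); split=> //.
  exact: dup_den_neq0.
by apply/esym/conj_dup_ratio; first exact: dup_den_neq0.
Qed.
End Conj.

Lemma dup_iso_conj W (psi : ratmap F) : ratmap_iso (dup W) psi ->
  exists al be, al != 0 /\ psi = dup (conj_curve al be W).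
Proof.
move=> [al [be [al0 [A [B [B0 h ->]]]]]]; exists al, be; split=> //.
exact: conj_dup_ratio.
Qed.

(** Up to the choice of the y-coordinate, a change of Weierstrass equation is
    an affine substitution of the x-coordinate. *)
Lemma weierstrass_iso_conj W W' : weierstrass_iso W W' ->
  exists al be, [/\ al != 0, dup_num W' = dup_num (conj_curve al be W),
    dup_den W' = dup_den (conj_curve al be W),
    wc4 W' = al ^+ 2 * wc4 W & wdisc W' = al ^+ 6 * wdisc W].
Proof.
case: W => a1 a2 a3 a4 a6 [u [r [s [t [u0]]]]] [/= h1 h2 h3 h4 h6].
set W := Weierstrass _ _ _ _ _.
exists (u ^- 2), (- r * u ^- 2); set al := u ^- 2; set be := - r * u ^- 2.
have al0 : al != 0 by rewrite invr_neq0 // expf_neq0.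
have b2E : wb2 W' = wb2 (conj_curve al be W).
  rewrite conj_b2; apply: (mulfI (expf_neq0 2 u0)).
  have -> : u ^+ 2 * wb2 W' = (u * wa1 W') ^+ 2 + 4%:R * (u ^+ 2 * wa2 W').
    by rewrite /wb2; ring.
  by rewrite h1 h2 /wb2 /al /be /=; field.
have b4E : wb4 W' = wb4 (conj_curve al be W).
  rewrite conj_b4; apply: (mulfI (expf_neq0 4 u0)).
  have -> : u ^+ 4 * wb4 W' = 2%:R * (u ^+ 4 * wa4 W') + (u * wa1 W') * (u ^+ 3 * wa3 W').
    by rewrite /wb4; ring.
  by rewrite h1 h3 h4 /wb4 /wb2 /al /be /=; field.
have b6E : wb6 W' = wb6 (conj_curve al be W).
  rewrite conj_b6; apply: (mulfI (expf_neq0 6 u0)).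
  have -> : u ^+ 6 * wb6 W' = (u ^+ 3 * wa3 W') ^+ 2 + 4%:R * (u ^+ 6 * wa6 W').
    by rewrite /wb6; ring.
  by rewrite h3 h6 /wb6 /wb4 /wb2 /al /be /=; field.
have [nE dE DE] := eq_dup four_neq0 b2E b4E b6E.
by split=> //; [rewrite /wc4 b2E b4E -/(wc4 _) conj_c4 | rewrite DE conj_disc].
Qed.

End Char.
End Duplication.

(** * Critical points of the duplication map *)

Section ClosedField.
Variable L : closedFieldType.
Implicit Types W : weierstrass L.

Lemma closed_sqrt (c : L) : exists x, x ^+ 2 = c.
Proof.
have /closed_rootP[x] : size ('X^2 - c%:P) != 1%N by rewrite size_XnsubC.
by rewrite /root !hornerE subr_eq0 => /eqP h; exists x.
Qed.

Hypothesis two_neq0 : (2%:R : L) != 0.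
Let h4 := four_neq0 two_neq0.

(** Vieta's formulas for e1, e2, e3 being the x-coordinates of the points of
    order 2, that is, the roots of the denominator. *)
Definition two_torsion W (e1 e2 e3 : L) :=
  [/\ wb2 W = - 4%:R * (e1 + e2 + e3),
      wb4 W = 2%:R * (e1 * e2 + e1 * e3 + e2 * e3),
      wb6 W = - 4%:R * (e1 * e2 * e3)
    & wb8 W = 4%:R * (e1 + e2 + e3) * (e1 * e2 * e3)
              - (e1 * e2 + e1 * e3 + e2 * e3) ^+ 2].

Lemma two_torsion_exists W : exists e1 e2 e3, two_torsion W e1 e2 e3.
Proof.
have [r hr] := closed_field_poly_normal (dup_den W).
have lc : lead_coef (dup_den W) = 4%:R by rewrite lead_coefE polyseq_dup_den.
have sr : size r = 3%N.
  have := congr1 (fun p : {poly L} => size p) hr.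
  by rewrite size_scale ?lc // size_prod_XsubC polyseq_dup_den // => -[<-].
move: r sr hr => [|e1 [|e2 [|e3 [|]]]] //= _; rewrite lc !big_cons big_nil mulr1 => hr.
exists e1, e2, e3.
have E : dup_den W = Poly [:: - 4%:R * (e1 * e2 * e3);
    4%:R * (e1 * e2 + e1 * e3 + e2 * e3); - 4%:R * (e1 + e2 + e3); 4%:R].
  rewrite hr /= !cons_poly_def -mul_polyC; ring.
have c i := congr1 (fun p : {poly L} => p`_i) E.
have := (c 0%N, c 1%N, c 2%N); rewrite /dup_den !coef_Poly /= => -[[c0 c1] c2].
have b4 : wb4 W = 2%:R * (e1 * e2 + e1 * e3 + e2 * e3).
  by apply: (mulfI two_neq0); rewrite c1; ring.
split=> //; apply: (mulfI h4); rewrite wb8E c0 c2 b4; ring.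
Qed.

Lemma two_torsion_disc W e1 e2 e3 : two_torsion W e1 e2 e3 ->
  wdisc W = 16%:R * ((e1 - e2) * (e1 - e3) * (e2 - e3)) ^+ 2.
Proof. by case=> h2 h4' h6 h8; rewrite wdiscE h2 h4' h6 h8; ring. Qed.

(** The critical points are the x-coordinates of the points of exact order 4:
    translation by a point of order 2 with x-coordinate e1 acts on the line by
    x -> e1 + (e1 - e2) (e1 - e3) / (x - e1), and its fixed points are
    e1 + s and e1 - s with s^2 = (e1 - e2) (e1 - e3). *)
Lemma dup_wronskian W e1 e2 e3 s1 s2 s3 : two_torsion W e1 e2 e3 ->
  s1 ^+ 2 = (e1 - e2) * (e1 - e3) -> s2 ^+ 2 = (e2 - e1) * (e2 - e3) ->
  s3 ^+ 2 = (e3 - e1) * (e3 - e2) ->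
  wronskian (dup_num W) (dup_den W) = 4%:R *:
    \prod_(z <- [:: e1 + s1; e1 - s1; e2 + s2; e2 - s2; e3 + s3; e3 - s3])
      ('X - z%:P).
Proof.
move=> [h2 h4' h6 h8] hs1 hs2 hs3.
have quad e s : ('X - (e + s)%:P) * ('X - (e - s)%:P) = ('X - e%:P) ^+ 2 - (s ^+ 2)%:P :> {poly L}.
  by ring.
have -> : \prod_(z <- [:: e1 + s1; e1 - s1; e2 + s2; e2 - s2; e3 + s3; e3 - s3])
      ('X - z%:P) = (('X - e1%:P) ^+ 2 - (s1 ^+ 2)%:P) *
    ((('X - e2%:P) ^+ 2 - (s2 ^+ 2)%:P) * (('X - e3%:P) ^+ 2 - (s3 ^+ 2)%:P)).
  by rewrite !big_cons big_nil mulr1 -!quad !mulrA.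
have dnum : (dup_num W)^`() = 4%:R%:P * 'X^3 - (2%:R * wb4 W)%:P * 'X
    - (2%:R * wb6 W)%:P.
  rewrite dup_numE !mul_polyC !derivB !derivZ derivC !derivXn derivX /= -!mul_polyC; ring.
have dden : (dup_den W)^`() = 12%:R%:P * 'X^2 + (2%:R * wb2 W)%:P * 'X
    + (2%:R * wb4 W)%:P.
  rewrite dup_denE !mul_polyC !derivD !derivZ derivC !derivXn derivX /= -!mul_polyC; ring.
rewrite /wronskian dnum dden dup_numE dup_denE h2 h4' h6 h8 hs1 hs2 hs3 -mul_polyC.
ring.
Qed.

(** The difference of the two roots of the i-th quadratic factor contributes
    4 s_i^2, and the factors i and j contribute the square of their resultant
    4 (e_i - e_j)^2 (e_i - e_k) (e_j - e_k).  Each (e_i - e_j)^2 thus occurs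
    with exponent 5, with coefficient - 4^3 (4^3)^2; the leading coefficient
    contributes 4^10, and D^5 contains 16^5. *)
Lemma dup_poly_disc W :
  poly_disc (wronskian (dup_num W) (dup_den W)) = - 2%:R ^+ 18 * wdisc W ^+ 5.
Proof.
have [e1 [e2 [e3 h]]] := two_torsion_exists W.
have [s1 h1] := closed_sqrt ((e1 - e2) * (e1 - e3)).
have [s2 h2] := closed_sqrt ((e2 - e1) * (e2 - e3)).
have [s3 h3] := closed_sqrt ((e3 - e1) * (e3 - e2)).
rewrite (dup_wronskian h h1 h2 h3) poly_discE // (two_torsion_disc h) /=.
rewrite !big_cons !big_nil !mulr1.
(* The resultant of two of the quadratic factors. *)
have cross e f g s t : s ^+ 2 = (e - f) * (e - g) -> t ^+ 2 = (f - e) * (f - g) ->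
    ((f + t) - (e + s)) * ((f - t) - (e + s)) * ((f + t) - (e - s)) *
    ((f - t) - (e - s)) = 4%:R * (e - f) ^+ 2 * (e - g) * (f - g) :> L.
  move=> hs ht.
  have -> : ((f + t) - (e + s)) * ((f - t) - (e + s)) * ((f + t) - (e - s)) *
    ((f - t) - (e - s)) = ((e - f) ^+ 2 + s ^+ 2 - t ^+ 2) ^+ 2
      - 4%:R * (e - f) ^+ 2 * s ^+ 2 by ring.
  rewrite hs ht; ring.
have c12 := cross e1 e2 e3 s1 s2 h1 h2.
have c13 : _ = 4%:R * (e1 - e3) ^+ 2 * (e1 - e2) * (e3 - e2) :=
  cross e1 e3 e2 s1 s3 (etrans h1 (mulrC _ _)) h3.
have c23 : _ = 4%:R * (e2 - e3) ^+ 2 * (e2 - e1) * (e3 - e1) :=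
  cross e2 e3 e1 s2 s3 (etrans h2 (mulrC _ _)) (etrans h3 (mulrC _ _)).
transitivity (4%:R ^+ 10 * 64%:R * (s1 ^+ 2 * s2 ^+ 2 * s3 ^+ 2) *
  ((4%:R * (e1 - e2) ^+ 2 * (e1 - e3) * (e2 - e3)) *
   (4%:R * (e1 - e3) ^+ 2 * (e1 - e2) * (e3 - e2)) *
   (4%:R * (e2 - e3) ^+ 2 * (e2 - e1) * (e3 - e1))) ^+ 2); last first.
  rewrite h1 h2 h3; ring.
rewrite -c12 -c13 -c23 {c12 c13 c23 cross}.
have same e s : (e - s - (e + s)) ^+ 2 = 4%:R * s ^+ 2 :> L by ring.
rewrite !same.
move: (e2 + s2 - (e1 + s1)) (e2 - s2 - (e1 + s1)) (e2 + s2 - (e1 - s1)) (e2 - s2 - (e1 - s1))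
  (e3 + s3 - (e1 + s1)) (e3 - s3 - (e1 + s1)) (e3 + s3 - (e1 - s1)) (e3 - s3 - (e1 - s1))
  (e3 + s3 - (e2 + s2)) (e3 - s3 - (e2 + s2)) (e3 + s3 - (e2 - s2)) (e3 - s3 - (e2 - s2)).
move=> d1 d2 d3 d4 d5 d6 d7 d8 d9 d10 d11 d12; ring.
Qed.

Lemma dup_critical_roots W : wdisc W != 0 -> exists r : seq L,
  [/\ uniq r, size r = 6%N &
      wronskian (dup_num W) (dup_den W) = 4%:R *: \prod_(z <- r) ('X - z%:P)].
Proof.
move=> D0; have [e1 [e2 [e3 h]]] := two_torsion_exists W.
have [s1 h1] := closed_sqrt ((e1 - e2) * (e1 - e3)).
have [s2 h2] := closed_sqrt ((e2 - e1) * (e2 - e3)).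
have [s3 h3] := closed_sqrt ((e3 - e1) * (e3 - e2)).
have Wr := dup_wronskian h h1 h2 h3; eexists; split; last exact: Wr; last by [].
have := dup_poly_disc W; rewrite Wr poly_discE // => E.
rewrite -[uniq _]negbK -root_disc_eq0; apply/eqP => rd0.
move: E; rewrite rd0 mulr0 => /esym/eqP; apply/negP.
by rewrite mulf_neq0 ?oppr_eq0 ?expf_neq0.
Qed.

(** At e1 the numerator equals ((e1 - e2) (e1 - e3))^2. *)
Lemma dup_coprime W : wdisc W != 0 -> coprimep (dup_num W) (dup_den W).
Proof.
move=> D0; have [e1 [e2 [e3 h]]] := two_torsion_exists W.
have := D0; rewrite (two_torsion_disc h) => N0.
have [h2 h4' h6 h8] := h.
apply: Pdiv.ClosedField.root_coprimep => z; apply: contraLR; rewrite negbK => /eqP dz.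
have {dz} : 4%:R * ((z - e1) * (z - e2) * (z - e3)) = 0.
  rewrite -[RHS]dz /dup_den horner_Poly [RHS]/= h2 h4' h6; ring.
move=> /eqP; rewrite !mulf_eq0 (negPf h4) !subr_eq0 /= => hz.
have num : (dup_num W).[z] = z ^+ 4 - wb4 W * z ^+ 2 - 2%:R * wb6 W * z - wb8 W.
  by rewrite /dup_num horner_Poly /=; ring.
apply: contra N0 => /eqP; rewrite num h4' h6 h8.
case/orP: hz => [/orP[]|] /eqP -> {z num}.
- have -> : e1 ^+ 4 - 2%:R * (e1 * e2 + e1 * e3 + e2 * e3) * e1 ^+ 2 -
    2%:R * (- 4%:R * (e1 * e2 * e3)) * e1 - (4%:R * (e1 + e2 + e3) * (e1 * e2 * e3)
    - (e1 * e2 + e1 * e3 + e2 * e3) ^+ 2) = ((e1 - e2) * (e1 - e3)) ^+ 2 by ring.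
  by move=> /eqP; rewrite expf_eq0 /= => /eqP ->; rewrite mul0r expr0n mulr0.
- have -> : e2 ^+ 4 - 2%:R * (e1 * e2 + e1 * e3 + e2 * e3) * e2 ^+ 2 -
    2%:R * (- 4%:R * (e1 * e2 * e3)) * e2 - (4%:R * (e1 + e2 + e3) * (e1 * e2 * e3)
    - (e1 * e2 + e1 * e3 + e2 * e3) ^+ 2) = ((e1 - e2) * (e2 - e3)) ^+ 2 by ring.
  by move=> /eqP; rewrite expf_eq0 /= mulrAC => /eqP ->; rewrite mul0r expr0n mulr0.
- have -> : e3 ^+ 4 - 2%:R * (e1 * e2 + e1 * e3 + e2 * e3) * e3 ^+ 2 -
    2%:R * (- 4%:R * (e1 * e2 * e3)) * e3 - (4%:R * (e1 + e2 + e3) * (e1 * e2 * e3)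
    - (e1 * e2 + e1 * e3 + e2 * e3) ^+ 2) = ((e1 - e3) * (e2 - e3)) ^+ 2 by ring.
  by move=> /eqP; rewrite expf_eq0 /= -mulrA => /eqP ->; rewrite mulr0 expr0n mulr0.
Qed.

End ClosedField.

(** The double root of the cubic 4 x^3 + b2 x^2 + 2 b4 x + b6 gives the singular
    point, except in characteristic 2, where the cubic degenerates. *)
Lemma disc0_singular (k : closedFieldType) (W : weierstrass k) : wdisc W = 0 ->
  exists x y, singular_point W x y.
Proof.
move=> D0; have [two0|two_neq0] := eqVneq (2%:R : k) 0; last first.
  have h4 := four_neq0 two_neq0.
  have [e1 [e2 [e3 h]]] := two_torsion_exists two_neq0 W.
  have [e [f [h2 h4' h6]]] : exists e f : k, [/\ wb2 W = - 4%:R * (2%:R * e + f),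
      wb4 W = 2%:R * (e ^+ 2 + 2%:R * e * f) & wb6 W = - 4%:R * (e ^+ 2 * f)].
    have /eqP := two_torsion_disc h; rewrite D0 eq_sym mulf_eq0 expf_eq0 /= !mulf_eq0.
    rewrite -[16%N]/(4 * 4)%N natrM mulf_eq0 (negPf h4) /= !subr_eq0.
    case: h => -> -> -> _ /orP[/orP[]|] /eqP E.
    - by exists e2, e3; rewrite E; split; ring.
    - by exists e3, e2; rewrite E; split; ring.
    - by exists e3, e1; rewrite E; split; ring.
  case: W D0 h h2 h4' h6 => a1 a2 a3 a4 a6 _ _; rewrite /wb2 /wb4 /wb6 /= => h2 h4' h6.
  exists e, (- (a1 * e + a3) / 2%:R); split; last by field.
  - apply: (mulfI h4); apply/eqP; rewrite -subr_eq0; apply/eqP.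
    transitivity (- ((4%:R * e ^+ 3 + (a1 ^+ 2 + 4%:R * a2) * e ^+ 2
       + 2%:R * (2%:R * a4 + a1 * a3) * e + (a3 ^+ 2 + 4%:R * a6)))); first by field.
    rewrite h2 h4' h6; ring.
  - apply: (mulfI two_neq0); apply/eqP; rewrite -subr_eq0; apply/eqP.
    transitivity (- (6%:R * e ^+ 2 + (a1 ^+ 2 + 4%:R * a2) * e
       + (2%:R * a4 + a1 * a3))); first by field.
    rewrite h2 h4'; ring.
have nat2 n : (n.*2)%:R = 0 :> k by rewrite -muln2 natrM two0 mulr0.
have nat1 n : (n.*2.+1)%:R = 1 :> k by rewrite -addn1 natrD nat2 add0r.
have opp (x : k) : - x = x.
  by apply/eqP; rewrite eq_sym -subr_eq0 opprK -mulr2n -mulr_natl two0 mul0r.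
case: W D0 => a1 a2 a3 a4 a6; rewrite /wdisc /singular_point.
rewrite (nat2 2) (nat2 4) (nat1 13) (nat1 4) (nat1 1) two0 !mul0r !opp.
rewrite !(mul0r, addr0, add0r, mul1r) => D0.
have xx (x : k) : x + x = 0 by rewrite -[X in _ + X]opp subrr.
have [a10|a10] := eqVneq a1 0.
  have a30 : a3 = 0.
    apply/eqP; move/eqP: D0; rewrite a10 !(expr0n, mul0r, addr0, add0r) /=.
    by rewrite -exprM expf_eq0.
  have [x hx] := closed_sqrt a4.
  have [y hy] := closed_sqrt (x ^+ 3 + a2 * x ^+ 2 + a4 * x + a6).
  by exists x, y; rewrite a10 a30 !(mul0r, mul1r, addr0) hy hx xx.
exists (a3 / a1), (((a3 / a1) ^+ 2 + a4) / a1); split.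
- apply: (mulfI (expf_neq0 6 a10)); apply/eqP; rewrite -subr_eq0; apply/eqP.
  transitivity (a1 ^+ 2 ^+ 2 * (a1 ^+ 2 * a6 + a1 * a3 * a4 + a2 * a3 ^+ 2 + a4 ^+ 2)
    + a3 ^+ 2 ^+ 2 + a1 ^+ 2 * (a1 * a3) * a3 ^+ 2
    + 2%:R * (a1 ^+ 2 * a3 ^+ 2 * a4 - a1 ^+ 4 * a2 * a3 ^+ 2 - a1 ^+ 6 * a6)).
    by field.
  by rewrite D0 two0 mul0r addr0.
- by field.
- by rewrite mul0r add0r mulrC divfK // xx.
Qed.

(** * The duplication map in the critical family *)

(** The fibre polynomial through z vanishes at z, and its derivative there is
    the value of the Wronskian. *)
Lemma ramifiedE (F : fieldType) (A B : {poly F}) z :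
  ramified A B z = root (wronskian A B) z.
Proof.
rewrite /ramified; set g := (X in _ %| X).
have gz : root g z by rewrite /g /root hornerD hornerN !hornerZ mulrC subrr.
have g'z : g^`().[z] = (wronskian A B).[z].
  by rewrite /g /wronskian derivB !derivZ !hornerE.
move/factor_theorem: gz => [h hg]; rewrite hg expr2.
rewrite dvdp_mul2r ?polyXsubC_eq0 // dvdp_XsubCl /root -g'z hg.
by rewrite derivM derivXsubC !hornerE subrr mulr0 add0r.
Qed.

Section Family.
Variables (K : fieldExtType rat) (Kbar : closedFieldType).
Variable iota : {rmorphism K -> Kbar}.
Implicit Types W : weierstrass K.

Lemma two_neq0K : (2%:R : K) != 0. Proof. by rewrite natrK_eq0. Qed.

Lemma two_neq0Kbar : (2%:R : Kbar) != 0.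
Proof. by rewrite -(rmorph_nat iota) fmorph_eq0 two_neq0K. Qed.

Let h4 := four_neq0 two_neq0K.

Lemma map_wdisc W : iota (wdisc W) = wdisc (map_weierstrass iota W).
Proof. case: W => a1 a2 a3 a4 a6; rewrite /wdisc /map_weierstrass /=; ring. Qed.

Lemma map_dup W :
  map_poly iota (dup_num W) = dup_num (map_weierstrass iota W) /\
  map_poly iota (dup_den W) = dup_den (map_weierstrass iota W).
Proof.
case: W => a1 a2 a3 a4 a6; rewrite /dup_num /dup_den /wb2 /wb4 /wb6 /wb8 /map_weierstrass.
split; apply/polyP => i; rewrite coef_map !coef_Poly.
  by case: i => [|[|[|[|[|i]]]]] /=; rewrite ?nth_nil; ring.
by case: i => [|[|[|[|i]]]] /=; rewrite ?nth_nil; ring.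
Qed.

Lemma map_wronskian (A B : {poly K}) : map_poly iota (wronskian A B) =
  wronskian (map_poly iota A) (map_poly iota B).
Proof. by rewrite /wronskian rmorphB !rmorphM /= !deriv_map. Qed.

Lemma map_dup_wronskian W : map_poly iota (wronskian (dup_num W) (dup_den W)) =
  wronskian (dup_num (map_weierstrass iota W)) (dup_den (map_weierstrass iota W)).
Proof. by rewrite map_wronskian; case: (map_dup W) => -> ->. Qed.

(** The discriminant computed over Kbar comes from K, and iota is injective. *)
Lemma dup_critical_disc W :
  critical_disc iota (dup_num W) (dup_den W) = - 2%:R ^+ 18 * wdisc W ^+ 5.
Proof.
have E : iota (- 2%:R ^+ 18 * wdisc W ^+ 5) =
    poly_disc (map_poly iota (wronskian (dup_num W) (dup_den W))).
  rewrite map_dup_wronskian dup_poly_disc ?two_neq0Kbar // -map_wdisc.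
  by rewrite rmorphM rmorphN !rmorphXn rmorph_nat.
rewrite /critical_disc; case: xgetP => [D _ hD|/(_ _ E)//].
by apply: (fmorph_inj iota); rewrite E.
Qed.

Lemma dup_coprimeK W : wdisc W != 0 -> coprimep (dup_num W) (dup_den W).
Proof.
move=> D0; rewrite -(coprimep_map iota); case: (map_dup W) => -> ->.
by apply: dup_coprime; rewrite ?two_neq0Kbar // -map_wdisc fmorph_eq0.
Qed.

Lemma dup_pair_degree W : pair_degree (dup_num W) (dup_den W) = 4%N.
Proof. by rewrite /pair_degree polyseq_dup_num polyseq_dup_den. Qed.

Lemma dup_lowest_terms W : wdisc W != 0 ->
  lowest_terms (dup W) (dup_num W) (dup_den W).
Proof.
move=> D0; split=> //; [exact: (dup_den_neq0 two_neq0K) | exact: dup_coprimeK].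
Qed.

Lemma recip0 n (P : {poly K}) : (recip n P).[0] = P`_n.
Proof. by rewrite horner_coef0 coef_poly subn0. Qed.

Lemma recip_deriv0 n (P : {poly K}) : (recip n.+1 P)^`().[0] = P`_n.
Proof. by rewrite horner_coef0 coef_deriv coef_poly mulr1n subn1. Qed.

Lemma dup_family W : wdisc W != 0 -> critical_family iota 4 4%:R (dup W).
Proof.
move=> D0; have low := dup_lowest_terms D0.
have nseq := polyseq_dup_num W; have dseq := polyseq_dup_den W h4.
split.
- by exists (dup_num W), (dup_den W); rewrite dup_pair_degree.
- exists (dup_num W), (dup_den W); split=> //.
  have [|r [ur sr Wr]] := @dup_critical_roots _ two_neq0Kbar (map_weierstrass iota W).
    by rewrite -map_wdisc fmorph_eq0.
  exists (map Some r); split; first by rewrite map_inj_uniq // => x y [].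
    by rewrite size_map sr.
  have h4b := four_neq0 two_neq0Kbar.
  (* At infinity the Wronskian of the reversed pair has value - 4. *)
  case=> [z|] /=; rewrite ramifiedE -map_wronskian.
    rewrite mem_map => [|x y []//].
    by rewrite map_dup_wronskian Wr rootZ // root_prod_XsubC.
  rewrite -{1}(rmorph0 iota) dup_pair_degree /root horner_map fmorph_eq0.
  rewrite /wronskian !(hornerD, hornerM, hornerN) !recip0 !recip_deriv0.
  rewrite nseq dseq /= mul0r mul1r sub0r oppr_eq0 (negPf h4).
  by apply/negP => /mapP[].
- exists (dup_num W), (dup_den W); split=> //=; rewrite dup_pair_degree.
  rewrite !recip0 !recip_deriv0 nseq dseq /= oner_neq0; split=> //.
    by rewrite mul0r.
  by rewrite mulr1 mul0r subr0 expr1n divr1.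
exists (dup_num W), (dup_den W); split=> //; first exact: dup_standard.
by rewrite nseq subrr mul0r mul0r.
Qed.

(** Being prime to the denominator, the numerator of the duplication map divides
    A, which is monic of the same degree. *)
Lemma dup_standard_unique W (A B : {poly K}) : wdisc W != 0 ->
  standard_form 4 4%:R A B -> dup W = ratio_of A B ->
  A = dup_num W /\ B = dup_den W.
Proof.
move=> D0 [monA sA sB lB] h; have [monN sN sD _] := dup_standard W h4.
have B0 : B != 0 by rewrite -size_poly_eq0 sB.
have d0 : dup_den W != 0 := dup_den_neq0 two_neq0K W.
have cross : dup_num W * B = A * dup_den W.
  move/eqP: h; rewrite /dup /ratio_of eqr_div ?tofrac_eq0 //.
  by rewrite -!tofracM tofrac_eq => /eqP.
have dv : dup_num W %| A.
  by rewrite -(Gauss_dvdpl _ (dup_coprimeK D0)) -cross dvdp_mulr.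
have AE : A = dup_num W.
  apply/esym/eqP; rewrite -eqp_monic // -(dvdp_size_eqp dv) sN sA.
  exact: eqxx.
split=> //; rewrite AE in cross; move: cross; rewrite -AE => /mulfI; apply.
by rewrite monic_neq0.
Qed.

End Family.

(** * Local comparison of the two discriminants *)

Lemma leastP (S : set nat) n : S n -> S (least S) /\ forall m, S m -> (least S <= m)%N.
Proof.
move=> Sn; have ex : exists n, `[< S n >] by exists n; apply/asboolP.
case: (ex_minnP ex) => m /asboolP Sm mmin.
have h : [set n | S n /\ forall m, S m -> (n <= m)%N] m.
  by split=> // j Sj; apply: mmin; apply/asboolP.
by rewrite /least; case: xgetP => [j _ []//|/(_ m)].
Qed.

Section Reduction.
Variables (K : fieldExtType rat) (v : place K).

Lemma weierstrass_integral_b (W : weierstrass K) : weierstrass_integral v W ->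
  [/\ vge v 0 (wb2 W), vge v 0 (wb4 W), vge v 0 (wb6 W) & vge v 0 (wb8 W)].
Proof.
case: W => a1 a2 a3 a4 a6 [/= h1 h2 h3 h4 h6].
rewrite /wb2 /wb4 /wb6 /wb8 /=; split;
  repeat first [assumption | apply: vge_nat | apply: vgeD | apply: vgeN
               | apply: vgeX | apply: vgeM0].
Qed.

Lemma wdisc_integral (W : weierstrass K) :
  weierstrass_integral v W -> vge v 0 (wdisc W).
Proof.
move=> /weierstrass_integral_b[h2 h4 h6 h8]; rewrite wdiscE.
repeat first [assumption | apply: vge_nat | apply: vgeD | apply: vgeN
             | apply: vgeX | apply: vgeM0].
Qed.

Variables (k : fieldType) (rho : K -> k).
Hypothesis hrho : reduction_map v rho.

(** The reduction map is a morphism on the valuation ring only; this relation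
    allows polynomial expressions to be reduced one operation at a time. *)
Definition reduces x z := vge v 0 x /\ rho x = z.

Lemma reduces0 : reduces 0 0.
Proof.
split; first exact: vge0.
have [_ rD _ _] := hrho; have z := @vge0 _ v 0.
by have := rD _ _ z z; rewrite addr0 => /eqP; rewrite -subr_eq subrr => /eqP.
Qed.

Lemma reducesD x y s t : reduces x s -> reduces y t -> reduces (x + y) (s + t).
Proof.
have [_ rD _ _] := hrho => -[hx <-] [hy <-].
by split; [exact: vgeD | exact: rD].
Qed.

Lemma reducesM x y s t : reduces x s -> reduces y t -> reduces (x * y) (s * t).
Proof.
have [_ _ rM _] := hrho => -[hx <-] [hy <-].
by split; [exact: vgeM0 | exact: rM].
Qed.

Lemma reduces_nat n : reduces n%:R n%:R.
Proof.
have [r1 _ _ _] := hrho.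
elim: n => [|n IH]; first exact: reduces0.
by rewrite -addn1 !natrD; apply: reducesD => //; split=> //; apply: vge1.
Qed.

Lemma reducesN x s : reduces x s -> reduces (- x) (- s).
Proof.
have [_ rD _ _] := hrho; have [_ r0] := reduces0 => -[hx <-].
split; first exact: vgeN.
have := rD _ _ hx (vgeN hx); rewrite subrr r0 => /esym/eqP.
by rewrite addr_eq0 => /eqP ->; rewrite opprK.
Qed.

Lemma reducesX x s n : reduces x s -> reduces (x ^+ n) (s ^+ n).
Proof.
move=> h; elim: n => [|n IH]; first exact: (reduces_nat 1).
by rewrite !exprS; apply: reducesM.
Qed.

Variable W : weierstrass K.
Hypothesis intW : weierstrass_integral v W.

Lemma reduces_b : reduces (wb2 W) (wb2 (map_weierstrass rho W)) /\
  reduces (wb4 W) (wb4 (map_weierstrass rho W)).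
Proof.
case: W intW => a1 a2 a3 a4 a6 [/= h1 h2 h3 h4 h6]; rewrite /wb2 /wb4 /=; split;
  repeat first [by split | apply: reduces_nat | apply: reducesD | apply: reducesN
               | apply: reducesX | apply: reducesM].
Qed.

Lemma reduces_disc : reduces (wdisc W) (wdisc (map_weierstrass rho W)).
Proof.
case: W intW => a1 a2 a3 a4 a6 [/= h1 h2 h3 h4 h6]; rewrite /wdisc /=;
  repeat first [by split | apply: reduces_nat | apply: reducesD | apply: reducesN
               | apply: reducesX | apply: reducesM].
Qed.

Lemma reduces_unit x z : reduces x z -> z != 0 -> x != 0 /\ v x = 0.
Proof.
have [_ _ _ rK] := hrho => -[hx <-] rx; apply: unit_of_vge => // x1.
by move/eqP: rx; apply; apply/rK.
Qed.

(** At a singular point c4 = (b2 + 12 x)^2, and b2 + 12 x is the discriminant of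
    the tangent cone, which does not vanish at a node. *)
Lemma node_c4_unit x y : node (map_weierstrass rho W) x y ->
  wc4 W != 0 /\ v (wc4 W) = 0.
Proof.
have [r2 r4] := reduces_b; set W' := map_weierstrass rho W => -[sing [m1 [m2 [m12 hs hp]]]].
apply: (@reduces_unit _ (wc4 W')).
  apply: reducesD; first exact: reducesX.
  by apply: reducesN; apply: reducesM => //; apply: reduces_nat.
have b4E : wb4 W' = - (wb2 W' * x + 6%:R * x ^+ 2).
  move: sing; case: (W') => a1 a2 a3 a4 a6 [_ h1 h2]; rewrite /wb2 /wb4 /=.
  apply/eqP; rewrite -subr_eq0; apply/eqP.
  transitivity (2%:R * (3%:R * x ^+ 2 + 2%:R * a2 * x + a4) - 2%:R * (a1 * y)
    + a1 * (2%:R * y + a1 * x + a3)); first by ring.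
  by rewrite -h1 h2 subrr mulr0 addr0.
have -> : wc4 W' = ((m1 - m2) ^+ 2) ^+ 2.
  have -> : (m1 - m2) ^+ 2 = (m1 + m2) ^+ 2 - 4%:R * (m1 * m2) by ring.
  rewrite hs hp /wc4 b4E /wb2; ring.
by rewrite !expf_neq0 // subr_eq0.
Qed.

End Reduction.

Section Local.
Variables (K : fieldExtType rat) (Kbar : closedFieldType).
Variable iota : {rmorphism K -> Kbar}.
Implicit Types (E : elliptic_curve K) (v : place K).

Let h2 := @two_neq0K K.
Let h4 := four_neq0 h2.

Local Notation crit E := (critical_min_exponent iota 4 4%:R (dup E)).

Lemma dup_disc_val v (W : weierstrass K) : wdisc W != 0 ->
  v (- 2%:R ^+ 18 * wdisc W ^+ 5) = 18%:Z * v 2%:R + 5%:Z * v (wdisc W).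
Proof.
move=> D0; have n0 : (-1 : K) != 0 by rewrite oppr_eq0 oner_neq0.
rewrite -mulN1r -mulrA ordvM ?mulf_neq0 ?expf_neq0 // ordvN1 add0r.
by rewrite ordvM ?expf_neq0 // !ordvX // mulrC [v (wdisc W) * _]mulrC.
Qed.

Lemma ordv_two_ge0 v : 0 <= v 2%:R.
Proof. exact: vge_neq0 h2 (vge_nat v 2). Qed.

Lemma weierstrass_iso_disc_neq0 E W : weierstrass_iso E W -> wdisc W != 0.
Proof.
move=> /(weierstrass_iso_conj h2)[al [be [al0 _ _ _ ->]]].
by rewrite mulf_neq0 ?expf_neq0 ?ec_disc_neq0.
Qed.

Definition crit_values E v : set nat := [set n | exists A B,
    [/\ standard_form 4 4%:R A B,
        forall i, valuation_ring v A`_i /\ valuation_ring v B`_i,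
        ratmap_iso (dup E) (ratio_of A B)
      & v (critical_disc iota A B) = n%:Z]].

(** An integral Weierstrass equation gives an integral standard pair. *)
Lemma crit_valuesP E v W : weierstrass_iso E W -> weierstrass_integral v W ->
  crit_values E v (crit E v) /\ (crit E v)%:Z <= 18%:Z * v 2%:R + 5%:Z * v (wdisc W).
Proof.
move=> iso intW; have D0 := weierstrass_iso_disc_neq0 iso.
have [b2 b4 b6 b8] := weierstrass_integral_b intW.
have vD := vge_neq0 D0 (wdisc_integral intW); have v2 := ordv_two_ge0 v.
have Sn : crit_values E v (absz (18%:Z * v 2%:R + 5%:Z * v (wdisc W))).
  exists (dup_num W), (dup_den W); split.
  - exact: dup_standard.
  - move=> i; rewrite polyseq_dup_num polyseq_dup_den //.
    split; case: i => [|[|[|[|[|i]]]]] /=; rewrite ?nth_nil -/(vge v 0 _);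
    repeat first [assumption | exact: vge0 | exact: vge1 | apply: vge_nat
                 | apply: vgeN | apply: vgeM0].
  - have [al [be [al0 nE dE _ _]]] := weierstrass_iso_conj h2 iso.
    by rewrite nE dE; apply: conj_dup_iso.
  - rewrite dup_critical_disc dup_disc_val //; lia.
have [S1 S2] := leastP Sn; split; first exact: S1.
have := S2 _ Sn; rewrite -[least _]/(crit E v).
lia.
Qed.

(** If c4 is a unit at v for one integral equation, then the multiplier of a
    substitution leading to an integral standard pair is integral at v, because
    c4 is multiplied by its square and stays integral: it is an integral
    polynomial in the coefficients of the denominator. *)
Lemma crit_values_ge E v W n : weierstrass_iso E W ->
  wc4 W != 0 -> v (wc4 W) = 0 -> crit_values E v n -> 5%:Z * v (wdisc W) <= n%:Z.
Proof.
move=> iso c0 vc [A [B [std int iso' hn]]].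
have [al [be [al0 _ _ cE dE]]] := weierstrass_iso_conj h2 iso.
have [al' [be' [al'0 hAB]]] := dup_iso_conj h2 iso'.
set W' := conj_curve al' be' E in hAB.
have cE' : wc4 W' = al' ^+ 2 * wc4 E by apply: conj_c4.
have dE' : wdisc W' = al' ^+ 6 * wdisc E by apply: conj_disc.
have E0 := ec_disc_neq0 E.
have D0 : wdisc W' != 0 by rewrite dE' mulf_neq0 ?expf_neq0.
have [AE BE] := dup_standard_unique iota D0 std (esym hAB).
rewrite AE BE dup_critical_disc dup_disc_val // in hn.
have cE0 : wc4 E != 0 by move: c0; rewrite cE mulf_eq0 => /norP[].
have c'0 : wc4 W' != 0 by rewrite cE' mulf_neq0 ?expf_neq0.
have c'int : vge v 0 (wc4 W').
  have [_ hb1] := int 1%N; have [_ hb2] := int 2%N.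
  rewrite BE polyseq_dup_den //= in hb1 hb2.
  have -> : wc4 W' = wb2 W' ^+ 2 - 12%:R * (2%:R * wb4 W') by rewrite /wc4; ring.
  by apply: vgeB; [apply: vgeX | apply: vgeM0 hb1; apply: vge_nat].
have := vge_neq0 c'0 c'int; rewrite cE' ordvM ?expf_neq0 // ordvX // => c'ge.
move: vc; rewrite cE ordvM ?expf_neq0 // ordvX // => vc.
have vD b : b != 0 -> v (b ^+ 6 * wdisc E) = v b * 6%:Z + v (wdisc E).
  by move=> b0; rewrite ordvM ?expf_neq0 // ordvX.
move: hn; rewrite dE dE' !vD // => hn.
have := ordv_two_ge0 v; lia.
Qed.

(** A reduction of discriminant 0 would have a singular point. *)
Lemma good_reduction_exponent E v : good_reduction E v -> ec_min_exponent E v = 0%N.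
Proof.
move=> [k [rho [W [hrho [iso intW hd] nsing]]]].
have [|_ vD] := reduces_unit hrho (reduces_disc hrho intW).
  apply/eqP => d0; have [x [y sxy]] := disc0_singular d0.
  exact: nsing sxy.
by move: hd; rewrite vD => -[].
Qed.

Lemma crit_exponent_ge E v : good_reduction E v \/ multiplicative_reduction E v ->
  (5 * ec_min_exponent E v <= crit E v)%N.
Proof.
case=> [/good_reduction_exponent->//|[k [rho [W [hrho [iso intW hd] [x [y hn]]]]]]].
have [c0 vc] := node_c4_unit hrho intW hn.
have [S1 _] := crit_valuesP iso intW.
have := crit_values_ge iso c0 vc S1; rewrite hd; lia.
Qed.

Lemma crit_exponent_supp E v : good_reduction E v \/ multiplicative_reduction E v ->
  crit E v != 0%N -> (ec_min_exponent E v != 0%N) || (v 2%:R != 0).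
Proof.
move=> red; have [W [iso intW hd]] : exists W, minimal_equation E v W.
  by case: red => -[k [rho [W [_ hW _]]]]; exists W.
have [_] := crit_valuesP iso intW; rewrite hd; lia.
Qed.

Lemma finite_nonintegral (x : K) : finite_set [set v : place K | ~ vge v 0 x].
Proof.
have [->|x0] := eqVneq x 0.
  by have -> : [set v : place K | ~ vge v 0 0] = set0;
    [apply/seteqP; split=> v //=; case; exact: vge0 | exact: finite_set0].
apply: sub_finite_set (finite_places x0) => v /= h; apply/eqP => vx; apply: h.
by right; rewrite vx.
Qed.

Lemma weierstrass_iso_refl E : weierstrass_iso E E.
Proof.
exists 1, 0, 0, 0; split; first exact: oner_neq0.
by case: E => -[a1 a2 a3 a4 a6] /= _; split; rewrite /=; ring.
Qed.

(** The given equation is integral with unit discriminant at almost all places. *)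
Lemma ec_finite_support E : finite_set [set v | ec_min_exponent E v != 0%N].
Proof.
have fin : finite_set ([set v | ~ vge v 0 (wa1 E)] `|` [set v | ~ vge v 0 (wa2 E)]
  `|` [set v | ~ vge v 0 (wa3 E)] `|` [set v | ~ vge v 0 (wa4 E)]
  `|` [set v | ~ vge v 0 (wa6 E)] `|` [set v : place K | v (wdisc E) != 0]).
  by rewrite !finite_setU; do ?split; try exact: finite_nonintegral;
     apply: finite_places; exact: ec_disc_neq0.
apply: sub_finite_set fin => v /= ev; apply: contrapT => h.
have H (P Q : Prop) : ~ (P \/ Q) -> ~ P /\ ~ Q by tauto.
move: h => /H[/H[/H[/H[/H[i1 i2] i3] i4] i6] vd].
have S0 : [set n | exists W, [/\ weierstrass_iso E W, weierstrass_integral v W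
                             & v (wdisc W) = n%:Z]] 0%N.
  exists E; split; first exact: weierstrass_iso_refl.
    by split; apply: contrapT.
  by apply/eqP; apply: contrapT => /negP.
have [_ /(_ _ S0)] := leastP S0.
by rewrite leqn0 => /eqP e0; rewrite /ec_min_exponent e0 in ev.
Qed.

End Local.

(** * Global comparison *)

Section Global.
Variables (K : fieldExtType rat) (Kbar : closedFieldType).
Variable iota : {rmorphism K -> Kbar}.

(** The constant M is the norm of the product of the primes above 2. *)
Lemma global_comparison : exists2 M : nat, (0 < M)%N &
  forall E : elliptic_curve K, semistable E ->
    (ideal_norm (ec_min_disc E) ^ 5 <=
       ideal_norm (critical_min_disc iota 4 4%:R (dup E)))%N /\
    (ideal_norm (radical (critical_min_disc iota 4 4%:R (dup E))) <=
       ideal_norm (radical (ec_min_disc E)) * M)%N.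
Proof.
have [q q0 normE] := ideal_norm_exponents K.
pose e2 (v : place K) : nat := v 2%:R != 0.
have fin2 : finite_set [set v | e2 v != 0%N].
  apply: sub_finite_set (finite_places (two_neq0K K)) => v /=.
  by rewrite /e2; case: (v 2%:R != 0).
exists (ideal_norm (exponent_ideal e2)).
  have /finite_seqP[s se] := fin2.
  rewrite (normE e2 (undup s)) ?undup_uniq //; last first.
    by move=> v ev; rewrite mem_undup; have : [set` s] v by rewrite -se.
  by apply: prodn_gt0 => v; rewrite expn_gt0 q0.
move=> E ss.
pose eE := ec_min_exponent E; pose eP := critical_min_exponent iota 4 4%:R (dup E).
have ge5 v : (5 * eE v <= eP v)%N := crit_exponent_ge iota (ss v).
have supp v : eP v != 0%N -> (eE v != 0%N) || (v 2%:R != 0) :=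
  crit_exponent_supp (iota := iota) (ss v).
have finE : finite_set [set v | eE v != 0%N] := ec_finite_support E.
have fin : finite_set ([set v | eE v != 0%N] `|` [set v | e2 v != 0%N]).
  by rewrite finite_setU.
have finP : finite_set [set v | eP v != 0%N].
  apply: sub_finite_set fin => v /= /supp /orP[?|v2]; first by left.
  by right; rewrite /= /e2 v2.
have -> : ec_min_disc E = exponent_ideal eE by exact: ideal_of_exponentsE.
have -> : critical_min_disc iota 4 4%:R (dup E) = exponent_ideal eP.
  by apply: ideal_of_exponentsE => // v; apply: (vge_nat v 4).
have /finite_seqP[s se] := fin.
have us := undup_uniq s.
have sE v : eE v != 0%N -> v \in undup s.
  by move=> ev; rewrite mem_undup; have : [set` s] v by rewrite -se; left.
have s2 v : e2 v != 0%N -> v \in undup s.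
  by move=> ev; rewrite mem_undup; have : [set` s] v by rewrite -se; right.
have sP v : eP v != 0%N -> v \in undup s.
  move=> /supp /orP[/sE //|v2]; by apply: s2; rewrite /e2 v2.
rewrite !radicalE // (normE _ _ us sE) (normE _ _ us sP) (normE _ _ us s2).
rewrite !(normE _ _ us) => [|v ev|v ev]; first last.
- by apply: sP; move: ev; case: (eP v).
- by apply: sE; move: ev; case: (eE v).
split.
  rewrite (big_morph (fun n => n ^ 5)%N (fun m n => expnMn m n 5) (exp1n 5)).
  by apply: leq_prod => v _; rewrite -expnM leq_pexp2l // mulnC.
rewrite -big_split; apply: leq_prod => v _ /=; rewrite -expnD leq_pexp2l //.
have := supp v; rewrite /e2; case: (eP v != 0%N) => // /(_ isT).
by case: (eE v != 0%N); case: (v 2%:R != 0).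
Qed.

End Global.

Local Close Scope classical_set_scope.

Theorem theorem10 (R : realType) (K : fieldExtType rat)
    (Kbar : closedFieldType) (iota : {rmorphism K -> Kbar})
    (iota_alg : forall z : Kbar, algebraicOver iota z) :
  (forall eps : R, 0 < eps -> exists C1 : R, 0 < C1 /\
     forall phi : ratmap K, critical_family iota 4 4%:R phi ->
       (ideal_norm (critical_min_disc iota 4 4%:R phi))%:R <=
       C1 * (ideal_norm (radical (critical_min_disc iota 4 4%:R phi)))%:R
            `^ (30%:R + eps)) ->
  forall eps : R, 0 < eps -> exists C2 : R, 0 < C2 /\
    forall E : elliptic_curve K, semistable E ->
      (ideal_norm (ec_min_disc E))%:R <=
      C2 * (ideal_norm (radical (ec_min_disc E)))%:R `^ (6%:R + eps).
Proof.
move=> bound eps eps0; have [M M0 comp] := global_comparison iota.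
have [|C1 [C10 hC]] := bound (5%:R * eps); first by rewrite mulr_gt0.
have MR : 0 < M%:R :> R by rewrite ltr0n.
exists (C1 `^ 5%:R^-1 * M%:R `^ (6%:R + eps)); split.
  by rewrite mulr_gt0 ?powR_gt0.
move=> E ss; have [h1 h2] := comp E ss.
have := hC _ (dup_family iota (ec_disc_neq0 E)).
move: (ideal_norm (critical_min_disc _ _ _ _)) h1 => nP h1.
move: (ideal_norm (radical (critical_min_disc _ _ _ _))) h2 => rP h2.
move: (ideal_norm (ec_min_disc E)) (ideal_norm (radical _)) h1 h2 => nE rE h1 h2 hP.
have inv5 : 0 <= 5%:R^-1 :> R by rewrite invr_ge0 ler0n.
have e0 : 0 <= 30%:R + 5%:R * eps by rewrite addr_ge0 ?mulr_ge0 ?ler0n // ltW.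
have h : nE%:R ^+ 5 <= C1 * (rE%:R * M%:R) `^ (30%:R + 5%:R * eps).
  apply: (@le_trans _ _ nP%:R); first by rewrite -natrX ler_nat.
  apply: le_trans hP _; rewrite ler_pM2l //.
  by apply: ge0_ler_powR => //; rewrite ?nnegrE ?mulr_ge0 ?ler0n // -natrM ler_nat.
have -> : nE%:R = (nE%:R ^+ 5) `^ 5%:R^-1 :> R.
  by rewrite -powR_mulrn ?ler0n // -powRrM divff ?pnatr_eq0 // powRr1 ?ler0n.
apply: (@le_trans _ _ ((C1 * (rE%:R * M%:R) `^ (30%:R + 5%:R * eps)) `^ 5%:R^-1)).
  by apply: ge0_ler_powR => //; rewrite nnegrE ?exprn_ge0 ?mulr_ge0 ?powR_ge0 ?ler0n // ltW.
rewrite powRM ?powR_ge0 ?(ltW C10) // -powRrM.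
have -> : (30%:R + 5%:R * eps) * 5%:R^-1 = 6%:R + eps by field.
by rewrite powRM ?ler0n // [rE%:R `^ _ * _]mulrC mulrA.
Qed.
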